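(* Let $\mu$ be a distribution on $\{0,1\}^n$. Let $\mathcal A$ be an $(m,T)$-distinguishing oracle and $\mathcal B$ an $(m,T)$-calibration oracle. Then there exists an algorithm $\mathcal S$ using $\mathcal A$ and $\mathcal B$ as subroutines such that for every $g^*:\{0,1\}^n\to\Delta_L$: (1) given $\varepsilon,\delta\in(0,1/2)$, $\mathcal S$ additionally takes $\mathrm{poly}(m,\log L,1/\varepsilon,\log(1/\delta))$ i.i.d.\ data points from $\mu_{g^*}$ as input and returns a function $s:\{0,1\}^n\to\Delta_L$ in time $\mathrm{poly}(m,T,L,1/\varepsilon,\log(1/\delta))$, and for any $x\in\{0,1\}^n$ the value $s(x)$ can be evaluated in time $\mathrm{poly}(m,T,L,1/\varepsilon,\log(1/\delta))$; (2) with probability at least $1-\delta$ over the draw of the data points, $s$ is simultaneously $(\mathcal A,\varepsilon,\Omega(\delta\varepsilon^2/\log L))$-indistinguishable from $g^*$ and $(\mathcal B,\varepsilon,\Omega(\delta\varepsilon^2/\log L))$-calibrated w.r.t.\ $g^*$.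
   Context: $\Delta_L$ is the set of probability distributions on $[L]$. For $g:\{0,1\}^n\to\Delta_L$, $\mu_g$ is the distribution of $(x,y)$ with $x\sim\mu$, $y\sim g(x)$; for $g,g^*$, $\mu_{g,g^*}$ is the distribution of $(x,y,y^* )$ with $x\sim\mu$ and then independently $y\sim g(x)$, $y^*\sim g^*(x)$. For $g,h:\{0,1\}^n\to\mathbb R^L$, $\langle g,h\rangle:=\mathbb E_{x\sim\mu}\langle g(x),h(x)\rangle$. An $(m,T)$-distinguishing oracle is a time-$T$ algorithm taking $m$ points $(x_i,y_i,y_i^* )\in\{0,1\}^n\times[L]\times[L]$ and outputting (a description of) $f:\{0,1\}^n\to[-1,1]^L$ evaluable in time $T$. An $(m,T)$-calibration oracle is a time-$T$ algorithm taking $m$ points $(v_i,y_i,y_i^* )\in\Delta_L\times[L]\times[L]$ and outputting (a description of) $r:\Delta_L\to[-1,1]^L$ evaluable in time $T$. $g$ is $(\mathcal A,\varepsilon,\delta)$-distinguishable from $g^*$ if with probability at least $1-\delta$ over $m$ i.i.d.\ draws from $\mu_{g,g^*}$ given to $\mathcal A$, the output $f$ satisfies $\langle g-g^*,f\rangle>\varepsilon$; otherwise $g$ is $(\mathcal A,\varepsilon,\delta)$-indistinguishable. $g$ is $(\mathcal B,\varepsilon,\delta)$-miscalibrated w.r.t.\ $g^*$ if with probability at least $1-\delta$ over $m$ i.i.d.\ draws $(x_i,y_i,y_i^* )\sim\mu_{g,g^*}$, given $(g(x_i),y_i,y_i^* )$ as input to $\mathcal B$, the output $r$ satisfies $\langle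 g-g^*,r\circ g\rangle>\varepsilon$; otherwise $g$ is $(\mathcal B,\varepsilon,\delta)$-calibrated w.r.t.\ $g^*$. *)

(* Defs.v *)
From mathcomp Require Import all_boot all_order all_algebra.
From mathcomp Require Import boolp reals exp.
From mathcomp Require mpoly.

Set Implicit Arguments.
Unset Strict Implicit.
Unset Printing Implicit Defensive.

Import Order.TTheory GRing.Theory Num.Theory.
Local Open Scope ring_scope.

(** * Algorithms

    The model is a randomized WHILE language over binary trees, as in Jones's
    "Computability and Complexity from a Programming Perspective", whose atoms
    are exact real numbers with unit-cost field operations and comparisons, as
    in the Blum-Shub-Smale model.  Copying a tree costs one step, because trees
    are immutable and hence can be shared.  The program text contains no real
    constant other than 1, and running time is the number of small steps. *)

(* Variables are natural numbers. *)
Inductive expr : Type :=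
| ENil
| EOne
| EVar of nat
| ECons of nat & nat
| EHd of nat
| ETl of nat
| EAdd of nat & nat
| ESub of nat & nat
| EMul of nat & nat
| EDiv of nat & nat
| ELe of nat & nat.

(* [Flip x y] sets [x] to true with probability [y] (truncated to [0, 1]), and
   to false otherwise.  [Call x k y] runs the [k]-th subroutine on the value of
   [y], in a fresh store, and puts its result in [x]. *)
Inductive cmd : Type :=
| Skip
| Assign of nat & expr
| Flip of nat & nat
| Call of nat & nat & nat
| Seq of cmd & cmd
| If of nat & cmd & cmd
| While of nat & cmd.

Section Semantics.
Variable R : realType.

Inductive val : Type :=
| Nil
| Num of R
| Cons of val & val.

Definition store := nat -> val.

Definition upd (s : store) (x : nat) (v : val) : store :=
  fun y => if y == x then v else s y.

Definition hd (v : val) : val := if v is Cons a _ then a else Nil.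
Definition tl (v : val) : val := if v is Cons _ b then b else Nil.
Definition num (v : val) : R := if v is Num r then r else 0.

(* As in Lisp, [Nil] is false and every other value is true. *)
Definition truth (v : val) : bool := if v is Nil then false else true.
Definition of_bool (b : bool) : val := if b then Num 1 else Nil.

Definition eval_expr (s : store) (e : expr) : val :=
  match e with
  | ENil => Nil
  | EOne => Num 1
  | EVar x => s x
  | ECons x y => Cons (s x) (s y)
  | EHd x => hd (s x)
  | ETl x => tl (s x)
  | EAdd x y => Num (num (s x) + num (s y))
  | ESub x y => Num (num (s x) - num (s y))
  | EMul x y => Num (num (s x) * num (s y))
  | EDiv x y => Num (num (s x) / num (s y))
  | ELe x y => of_bool (num (s x) <= num (s y))
  end.

(* A configuration is a stack of frames together with the current store.
   [Exec env c] remains to be executed with the subroutines [env]; [Return x s]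
   ends a call, restoring the store [s] of the caller and putting the result of
   the callee in [x].  Input and output are in variable 0. *)
Inductive frame : Type :=
| Exec of seq cmd & cmd
| Return of nat & store.

Definition config : Type := (seq frame * store)%type.

Definition init_store (v : val) : store := upd (fun=> Nil) 0 v.

Definition init (env : seq cmd) (c : cmd) (v : val) : config :=
  ([:: Exec env c], init_store v).

(* The possible successors of a configuration, with their probabilities.
   Subroutines have themselves no access to subroutines. *)
Definition step (cf : config) : seq (R * config) :=
  let: (fs, s) := cf in
  match fs with
  | [::] => [:: (1, cf)]
  | Return x s' :: fs => [:: (1, (fs, upd s' x (s 0)))]
  | Exec env c :: fs =>
    match c with
    | Skip => [:: (1, (fs, s))]
    | Assign x e => [:: (1, (fs, upd s x (eval_expr s e)))]
    | Flip x y =>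
      let p := Num.max 0 (Num.min 1 (num (s y))) in
      [:: (p, (fs, upd s x (of_bool true)));
          (1 - p, (fs, upd s x (of_bool false)))]
    | Call x k y =>
      [:: (1, (Exec [::] (nth Skip env k) :: Return x s :: fs,
               init_store (s y)))]
    | Seq c1 c2 => [:: (1, (Exec env c1 :: Exec env c2 :: fs, s))]
    | If x c1 c2 =>
      [:: (1, (Exec env (if truth (s x) then c1 else c2) :: fs, s))]
    | While x c =>
      [:: (1, if truth (s x) then (Exec env c :: Exec env (While x c) :: fs, s)
              else (fs, s))]
    end
  end.

Definition halted_with (P : val -> Prop) (cf : config) : Prop :=
  cf.1 = [::] /\ P (cf.2 0).

(* Probability that, after [t] steps from [cf], the machine has halted and its
   output satisfies [P]. *)
Fixpoint prob_from (t : nat) (cf : config) (P : val -> Prop) : R :=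
  if t is t'.+1 then \sum_(o <- step cf) o.1 * prob_from t' o.2 P
  else (`[< halted_with P cf >])%:R.

Definition prob_returns (env : seq cmd) (c : cmd) (v : val) (t : nat)
    (P : val -> Prop) : R :=
  prob_from t (init env c v) P.

End Semantics.

Arguments Nil {R}.

(** * Distributions and encodings *)

Section Simulation.
Variable R : realType.

Record fdist (I : finType) : Type := FDist {
  fdist_val :> {ffun I -> R};
  fdistP : [forall i, 0 <= fdist_val i] && (\sum_i fdist_val i == 1)
}.

(* Mean of [F z] when [z] consists of [k] independent draws from [p]. *)
Definition iid_mean (Z : finType) (p : Z -> R) (k : nat)
    (F : k.-tuple Z -> R) : R :=
  \sum_(z : k.-tuple Z) (\prod_(i < k) p (tnth z i)) * F z.

Definition enc_seq (s : seq (val R)) : val R := foldr (@Cons R) Nil s.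

Definition enc_bits n (x : n.-tuple bool) : val R :=
  enc_seq [seq Num b%:R | b : bool <- x].

Definition enc_vec L (v : {ffun 'I_L -> R}) : val R :=
  enc_seq [seq Num (v y) | y <- enum 'I_L].

Definition enc_label L (y : 'I_L) : val R := Num (y : nat)%:R.

(* An algorithm whose output is a description of a function: [learn] computes
   the description, and [evaluate] maps a pair (description, point) to the value
   of the function at the point. *)
Record algorithm : Type := Algorithm { learn : cmd; evaluate : cmd }.

Definition describes (env : seq cmd) (S : algorithm) (t : nat) (D : Type)
    (enc : D -> val R) (L : nat) (d : val R) (f : D -> {ffun 'I_L -> R}) : Prop :=
  forall x : D,
    prob_returns env (evaluate S) (Cons d (enc x)) t
      (fun w => w = enc_vec (f x)) = 1.

Definition bounded (D : Type) (L : nat) (f : D -> {ffun 'I_L -> R}) : Prop :=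
  forall x y, -1 <= f x y <= 1.

Section Oracles.
Variables n L m T : nat.

Notation X := (n.-tuple bool).
Notation Delta := (fdist 'I_L).
Notation vec := {ffun 'I_L -> R}.

(* The distribution of (x, y), where x ~ mu and y ~ g(x). *)
Definition mu_1 (mu : fdist X) (g : X -> Delta) (z : X * 'I_L) : R :=
  mu z.1 * g z.1 z.2.

(* The distribution of (x, y, y'), where x ~ mu and then independently y ~ g(x)
   and y' ~ g'(x). *)
Definition mu_2 (mu : fdist X) (g g' : X -> Delta) (z : X * 'I_L * 'I_L) : R :=
  mu z.1.1 * g z.1.1 z.1.2 * g' z.1.1 z.2.

Definition inner (mu : fdist X) (g h : X -> vec) : R :=
  \sum_x mu x * \sum_y g x y * h x y.

(* <g - g', f> *)
Definition advantage (mu : fdist X) (g g' : X -> Delta) (f : X -> vec) : R :=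
  inner mu (fun x => (g x : vec) - (g' x : vec)) f.

Definition enc_triple (D : Type) (enc : D -> val R) (z : D * 'I_L * 'I_L) :
    val R :=
  Cons (enc z.1.1) (Cons (enc_label z.1.2) (enc_label z.2)).

Definition enc_simplex (v : Delta) : val R := enc_vec v.

Record distinguishing_oracle : Type := DistinguishingOracle {
  dist_alg :> algorithm;
  dist_algP : forall z : m.-tuple (X * 'I_L * 'I_L),
    prob_returns [::] (learn dist_alg)
      (enc_seq [seq enc_triple (@enc_bits n) p | p <- z]) T
      (fun d => exists f : X -> vec,
         bounded f /\ describes [::] dist_alg T (@enc_bits n) d f) = 1
}.

Record calibration_oracle : Type := CalibrationOracle {
  calib_alg :> algorithm;
  calib_algP : forall z : m.-tuple (Delta * 'I_L * 'I_L),
    prob_returns [::] (learn calib_alg)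
      (enc_seq [seq enc_triple enc_simplex p | p <- z]) T
      (fun d => exists r : Delta -> vec,
         bounded r /\ describes [::] calib_alg T enc_simplex d r) = 1
}.

(* Probabilities are over the draws and the coins, if any, of the oracle. *)

Definition distinguishable (mu : fdist X) (A : distinguishing_oracle)
    (eps delta : R) (g g' : X -> Delta) : Prop :=
  1 - delta <=
  iid_mean (mu_2 mu g g') (fun z : m.-tuple (X * 'I_L * 'I_L) =>
    prob_returns [::] (learn A)
      (enc_seq [seq enc_triple (@enc_bits n) p | p <- z]) T
      (fun d => exists f : X -> vec,
         describes [::] A T (@enc_bits n) d f /\ eps < advantage mu g g' f)).

Definition indistinguishable mu A eps delta g g' : Prop :=
  ~ distinguishable mu A eps delta g g'.

Definition miscalibrated (mu : fdist X) (B : calibration_oracle)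
    (eps delta : R) (g g' : X -> Delta) : Prop :=
  1 - delta <=
  iid_mean (mu_2 mu g g') (fun z : m.-tuple (X * 'I_L * 'I_L) =>
    prob_returns [::] (learn B)
      (enc_seq [seq enc_triple enc_simplex (g p.1.1, p.1.2, p.2) | p <- z]) T
      (fun d => exists r : Delta -> vec,
         describes [::] B T enc_simplex d r /\
         eps < advantage mu g g' (r \o g))).

Definition calibrated mu B eps delta g g' : Prop :=
  ~ miscalibrated mu B eps delta g g'.

(* The subroutines available to an algorithm with access to both oracles. *)
Definition subroutines (A : distinguishing_oracle) (B : calibration_oracle) :
    seq cmd :=
  [:: learn A; evaluate A; learn B; evaluate B].

Definition enc_data (eps delta : R) (N : nat) (z : N.-tuple (X * 'I_L)) :
    val R :=
  Cons (Num eps) (Cons (Num delta)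
    (enc_seq [seq Cons (enc_bits p.1) (enc_label p.2) | p <- z])).

(* Probability that [S], using the oracles on the data [z], returns within time
   [t] a description of some s : {0,1}^n -> Delta that satisfies [P] and can be
   evaluated in time [t']. *)
Definition prob_simulator (A : distinguishing_oracle) (B : calibration_oracle)
    (S : algorithm) (t t' : nat) (eps delta : R) (N : nat)
    (z : N.-tuple (X * 'I_L)) (P : (X -> Delta) -> Prop) : R :=
  prob_returns (subroutines A B) (learn S) (enc_data eps delta z) t
    (fun d => exists s : X -> Delta,
       describes (subroutines A B) S t' (@enc_bits n) d
         (fun x => (s x : vec)) /\
       P s).

End Oracles.

Definition peval (k : nat) (p : mpoly.mpoly k R) (v : k.-tuple R) : R :=
  mpoly.meval (tnth v) p.

End Simulation.

(* Main.v *)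
(* The simulator starts from the uniform function and repeatedly asks A and B, on fresh data
   relabelled by the current s, for a function f; it estimates <s - gstar, f> on further fresh
   data and, if the estimate is at least 3 eps / 4, replaces s by the multiplicative-weights
   update proportional to s (1 - eta f), with eta = eps / 8.  The linear factor 1 - eta f, instead
   of an exponential, keeps the update computable with field operations.  It stops as soon as
   both oracles have failed on the same s.

   If the test is right, an update lowers the cross entropy of gstar relative to s, which is
   nonnegative and initially ln L, by eps^2 / 32; hence there are O(ln L / eps^2) rounds.  In a
   round where A (or B) distinguishes s from gstar with failure probability delta', the simulator
   stops wrongly only if A fails or the test errs, and the latter is controlled by a Chernoff
   bound; a union bound over the rounds concludes.

   Programs are only bounded from below: every claim is a lower bound on the mean of a nonnegative
   function of the final store, so branches of different lengths and runs that time out need no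
   special care. *)
Require Import Defs.
From mathcomp Require Import all_boot all_order all_algebra.
From mathcomp Require Import boolp reals sequences exp.
From mathcomp Require mpoly.
From mathcomp Require Import ring lra zify.

Set Implicit Arguments.
Unset Strict Implicit.
Unset Printing Implicit Defensive.

(* Importing [Defs] again makes [val], [Num], [Nil] and [Cons] refer to machine values. *)
Import Order.TTheory GRing.Theory Num.Theory Defs.
Local Open Scope ring_scope.

(** * Expected values of programs *)

(** The program is fixed before [eps] and [delta] are known, and its field operations give neither
    logarithms nor exponentials, so it counts neither rounds nor test points. A test multiplies a
    register by [1 + eps ^+ 2 / 512] per point, from [delta * eps ^+ 2 / (132 * L)] until it exceeds
    1. The Chernoff bound gains the same factor per point, so the error probability of a test is at
    most the starting value. The rounds end at the latest when the data run out, and the number of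
    data points is chosen accordingly. A simulated function is described by the list of the oracle
    outputs that led to it, and evaluated by replaying this list with one oracle call per entry; the
    cost is linear in the number of updates and does not compound. The proof has two halves that
    meet in [process], a recursive mean over histories and data without stores or running times: the
    program is bounded below by [process], and [process] is then averaged over i.i.d. data. *)

Section ExpectedValue.
Variable R : realType.
Implicit Types (s : store R) (fs : seq (frame R)) (cf : config R).
Implicit Types (phi psi : store R -> R) (t : nat) (env : seq cmd) (c : cmd).

(* Runs that have not halted after [t] steps count as 0. *)
Fixpoint ev t cf phi : R :=
  if t is t'.+1 then \sum_(o <- step cf) o.1 * ev t' o.2 phi
  else if cf.1 is [::] then phi cf.2 else 0.

Lemma step_ge0 cf o : o \in [seq p.1 | p <- step cf] -> 0 <= o.
Proof.
case: cf => -[|[env c|x s'] fs] s; rewrite /= ?inE; try by move=> /eqP->.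
case: c => [|x e|x y|x k y|c1 c2|x c1 c2|x c]; rewrite ?inE; try by move=> /eqP->.
by move=> /orP[] /eqP->; rewrite ?subr_ge0 ?ge_max ?ge_min ?le_max ?lexx ?ler01.
Qed.

Lemma step_sum1 cf : \sum_(o <- step cf) o.1 = 1.
Proof.
case: cf => -[|[env c|x s'] fs] s; rewrite /= ?big_seq1 //.
by case: c => *; rewrite ?big_seq1 // big_cons big_seq1 /= addrC subrK.
Qed.

Lemma ler_step (F G : config R -> R) cf : (forall cf', F cf' <= G cf') ->
  \sum_(o <- step cf) o.1 * F o.2 <= \sum_(o <- step cf) o.1 * G o.2.
Proof.
move=> FG; have := @step_ge0 cf; elim: (step cf) => [|o l IH] h.
  by rewrite !big_nil.
rewrite !big_cons lerD ?ler_wpM2l ?h ?mem_head //.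
by apply: IH => p pl; apply: h; rewrite inE pl orbT.
Qed.

Lemma le_ev t cf phi psi : (forall s, phi s <= psi s) -> ev t cf phi <= ev t cf psi.
Proof.
move=> le; elim: t cf => [|t IH] cf /=; first by case: cf.1.
exact: (ler_step cf IH).
Qed.

Lemma ev_ge0 t cf phi : (forall s, 0 <= phi s) -> 0 <= ev t cf phi.
Proof.
move=> ge0; elim: t cf => [|t IH] cf /=; first by case: cf.1.
by apply: le_trans (ler_step (F := fun=> 0) cf IH); rewrite -mulr_suml mulr0.
Qed.

Lemma ev_halted t s phi : ev t ([::], s) phi = phi s.
Proof. by elim: t => //= t IH; rewrite big_seq1 mul1r. Qed.

Lemma ev_sum t cf (I : Type) (r : seq I) (w : I -> R) (F : I -> store R -> R) :
  ev t cf (fun s => \sum_(i <- r) w i * F i s) = \sum_(i <- r) w i * ev t cf (F i).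
Proof.
elim: t cf => [|t IH] cf /=.
  by case: cf.1 => // *; rewrite big1 // => i _; rewrite mulr0.
under eq_bigr do rewrite IH mulr_sumr.
rewrite exchange_big /=; apply: eq_bigr => i _; rewrite mulr_sumr.
by apply: eq_bigr => o _; rewrite mulrCA.
Qed.

Lemma ev_cst t cf (a : R) : 0 <= a -> ev t cf (fun=> a) <= a.
Proof.
move=> a0; elim: t cf => [|t IH] cf /=; first by case: cf.1.
by rewrite (le_trans (ler_step cf IH)) // -mulr_suml step_sum1 mul1r.
Qed.

(** A halted machine idles without changing its store, and a run that has not halted counts as 0,
    which is at most [phi]. Hence time left over by the first part can go to the second, at the
    price of an inequality. *)
Lemma ev_cat t1 t2 fs1 fs2 s phi : (forall s, 0 <= phi s) ->
  ev t1 (fs1, s) (fun s' => ev t2 (fs2, s') phi) <= ev (t1 + t2) (fs1 ++ fs2, s) phi.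
Proof.
move=> ge0.
have leS t cf : ev t cf phi <= ev t.+1 cf phi.
  elim: t cf => [|t IH] cf; last exact: (ler_step cf IH).
  case: cf => -[|f fs] s' /=; first by rewrite big_seq1 mul1r.
  by have := ev_ge0 1 (f :: fs, s') ge0.
elim: t1 fs1 s => [|t1 IH] [|f fs1] s.
- by [].
- exact: ev_ge0.
- rewrite ev_halted; move: (t1.+1) => k /=.
  by elim: k => // k IHk; rewrite (le_trans IHk) ?addSn ?leS.
(* Frames below the top one do not influence a step. *)
have E : step ((f :: fs1) ++ fs2, s) =
    [seq (o.1, (o.2.1 ++ fs2, o.2.2)) | o <- step (f :: fs1, s)].
  by case: f => [env [] *|x s'] //=; case: ifP.
rewrite addSn [X in _ <= X]/ev -/ev E big_map.
by apply: (ler_step (F := fun cf => ev t1 cf (fun s' => ev t2 (fs2, s') phi))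
  (G := fun cf => ev (t1 + t2) (cf.1 ++ fs2, cf.2) phi)) => -[fs s']; exact: IH.
Qed.

Lemma ev_leq t t' cf phi : (forall s, 0 <= phi s) -> (t <= t')%N ->
  ev t cf phi <= ev t' cf phi.
Proof.
case: cf => fs s ge0 /subnK <-; rewrite addnC -[in X in _ <= X](cats0 fs).
apply: le_trans (ev_cat _ _ _ _ _ ge0); apply: le_ev => s'.
by rewrite ev_halted.
Qed.

Lemma evS t cf phi : ev t.+1 cf phi = \sum_(o <- step cf) o.1 * ev t o.2 phi.
Proof. by []. Qed.

Arguments ev : simpl never.

Definition wp env c t phi s : R := ev t ([:: Exec R env c], s) phi.

(* With probability 1, [c] halts within [t] steps in a store satisfying [Q]. *)
Definition ok env c t s (Q : store R -> Prop) : Prop := forall phi (b : R),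
  (forall s', 0 <= phi s') -> (forall s', Q s' -> b <= phi s') -> b <= wp env c t phi s.

Lemma wp_ge0 env c t phi s : (forall s', 0 <= phi s') -> 0 <= wp env c t phi s.
Proof. exact: ev_ge0. Qed.

Lemma wp_leq env c t t' phi s : (forall s', 0 <= phi s') -> (t <= t')%N ->
  wp env c t phi s <= wp env c t' phi s.
Proof. exact: ev_leq. Qed.

Lemma wp_seq env c1 c2 t1 t2 phi s : (forall s', 0 <= phi s') ->
  wp env c1 t1 (wp env c2 t2 phi) s <= wp env (Seq c1 c2) (t1 + t2).+1 phi s.
Proof.
move=> ge0; rewrite [X in _ <= X]/wp evS /= big_seq1 mul1r.
exact: (ev_cat _ _ [:: Exec R env c1] [:: Exec R env c2]).
Qed.

Lemma wp_if env x c1 c2 t phi s :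
  wp env (If x c1 c2) t.+1 phi s = wp env (if truth (s x) then c1 else c2) t phi s.
Proof. by rewrite /wp evS /= big_seq1 mul1r. Qed.

Lemma wp_while env x c t1 t2 phi s : (forall s', 0 <= phi s') -> truth (s x) ->
  wp env c t1 (wp env (While x c) t2 phi) s <= wp env (While x c) (t1 + t2).+1 phi s.
Proof.
move=> ge0 sx; rewrite [X in _ <= X]/wp evS /= sx big_seq1 mul1r.
exact: (ev_cat _ _ [:: Exec R env c] [:: Exec R env (While x c)]).
Qed.

Lemma wp_while_exit env x c t phi s : ~~ truth (s x) ->
  wp env (While x c) t.+1 phi s = phi s.
Proof. by move=> /negPf sx; rewrite /wp evS /= sx big_seq1 mul1r ev_halted. Qed.

Lemma wp_flip env x y t phi s : 0 <= num (s y) <= 1 ->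
  wp env (Flip x y) t.+1 phi s = num (s y) * phi (upd s x (of_bool R true)) +
    (1 - num (s y)) * phi (upd s x (of_bool R false)).
Proof.
move=> /andP[q0 q1]; rewrite /wp evS /= big_cons big_seq1 !ev_halted.
by rewrite (min_idPr q1) (max_idPr q0).
Qed.

(** Of the two extra steps, one enters the call and the other executes [Return]. *)
Lemma wp_call env x k y t phi s : (forall s', 0 <= phi s') ->
  ev t (init [::] (nth Skip env k) (s y)) (fun s' => phi (upd s x (s' 0))) <=
  wp env (Call x k y) t.+2 phi s.
Proof.
move=> ge0; rewrite [X in _ <= X]/wp evS /= big_seq1 mul1r -addn1.
apply: le_trans (ev_cat _ _ [:: Exec R [::] _] [:: Return x s] _ ge0).
by apply: le_ev => s'; rewrite evS /= big_seq1 mul1r.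
Qed.

Lemma prob_from_ev t cf (P : val R -> Prop) :
  prob_from t cf P = ev t cf (fun s => (`[< P (s 0) >])%:R).
Proof.
elim: t cf => [|t IH] [fs s]; last by rewrite evS; apply: eq_bigr => o _; congr (_ * _); exact: IH.
rewrite /= /ev; case: fs => [|f fs]; rewrite /halted_with /=.
  by congr (nat_of_bool _)%:R; apply: asbool_equiv_eq; split=> [[]|].
by rewrite asboolF // => -[].
Qed.

Lemma ev_markov t cf (P : val R -> Prop) phi (b : R) : 0 <= b ->
  (forall s, 0 <= phi s) -> (forall s, P (s 0) -> b <= phi s) ->
  b * prob_from t cf P <= ev t cf phi.
Proof.
move=> b0 ge0 le; rewrite prob_from_ev.
have := ev_sum t cf [:: tt] (fun=> b) (fun=> fun s => (`[< P (s 0) >])%:R).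
rewrite big_seq1 => <-; apply: le_ev => s; rewrite big_seq1.
by case: asboolP => [/le|_]; rewrite ?mulr1 // mulr0.
Qed.

Lemma ev_ok t cf (P : val R -> Prop) phi (b : R) : prob_from t cf P = 1 ->
  (forall s, 0 <= phi s) -> (forall s, P (s 0) -> b <= phi s) -> b <= ev t cf phi.
Proof.
move=> p1 ge0 le; have [b0|b0] := leP b 0; first exact: le_trans b0 (ev_ge0 _ _ ge0).
by rewrite -(mulr1 b) -p1; apply: ev_markov => //; exact: ltW.
Qed.

Lemma prob_from_le1 t cf (P : val R -> Prop) : prob_from t cf P <= 1.
Proof.
rewrite prob_from_ev (le_trans _ (ev_cst t cf ler01)) //; apply: le_ev => s.
by case: asbool.
Qed.

Lemma le_prob_from t cf (P Q : val R -> Prop) : (forall w, P w -> Q w) ->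
  prob_from t cf P <= prob_from t cf Q.
Proof.
move=> PQ; rewrite !prob_from_ev; apply: le_ev => s.
case: (asboolP (P (s 0))) => [Ps|_]; last by case: asbool.
by rewrite (asboolT (PQ _ Ps)).
Qed.

Lemma prob_returns_leq env c v t t' (P : val R -> Prop) : (t <= t')%N ->
  prob_returns env c v t P = 1 -> prob_returns env c v t' P = 1.
Proof.
move=> tt p1; apply: le_anti; rewrite /prob_returns prob_from_le1 -p1 /prob_returns.
by rewrite !prob_from_ev ev_leq // => s; case: asbool.
Qed.

(** The indicators of [P] and [Q] add up to at most 1 plus the indicator of their conjunction, and
    the constant 1 has mean at most 1. *)
Lemma prob_fromI t cf (P Q : val R -> Prop) (a : R) : prob_from t cf P = 1 ->
  a <= prob_from t cf Q -> a <= prob_from t cf (fun w => P w /\ Q w).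
Proof.
rewrite !prob_from_ev => p1 le; set PQ := ev _ _ _.
suff : 1 + a <= 1 + PQ by rewrite lerD2l.
apply: le_trans (_ : 1 + PQ >= ev t cf (fun=> 1) + PQ); last first.
  by rewrite lerD2r ev_cst.
rewrite -{1}p1 (le_trans (lerD (lexx _) le)) // /PQ.
(* Numbering the functions lets [ev_sum], which is about weighted sums over an index, yield
   additivity. *)
pose F (i : nat) : store R -> R := nth (fun=> 0)
  [:: fun s => (`[< P (s 0) >])%:R; fun s => (`[< Q (s 0) >])%:R;
      fun=> 1; fun s => (`[< P (s 0) /\ Q (s 0) >])%:R] i.
have E i j : ev t cf (F i) + ev t cf (F j) = ev t cf (fun s => F i s + F j s).
  have := ev_sum t cf [:: i; j] (fun=> 1) F.
  rewrite !big_cons !big_nil !mul1r !addr0 => <-; congr ev.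
  by apply: funext => s; rewrite !big_cons !big_nil !mul1r !addr0.
rewrite (E 0 1) (E 2 3); apply: le_ev => s; rewrite /F /= asbool_and.
by do 2![case: asboolP => _]; rewrite /= ?addr0 ?add0r ?lexx ?ler01 // lerDl.
Qed.

Lemma ok_leq env c t t' s Q : (t <= t')%N -> ok env c t s Q -> ok env c t' s Q.
Proof.
by move=> tt' okc phi b ge0 le; apply: le_trans (okc _ _ ge0 le) (wp_leq _ _ _ ge0 tt').
Qed.

Lemma ok_imp env c t s (Q Q' : store R -> Prop) :
  ok env c t s Q -> (forall s', Q s' -> Q' s') -> ok env c t s Q'.
Proof. by move=> okc QQ' phi b ge0 le; apply: okc => // s' /QQ'; exact: le. Qed.

Lemma ok_prob env c t v (P : val R -> Prop) :
  ok env c t (init_store v) (fun s => P (s 0)) -> prob_returns env c v t P = 1.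
Proof.
move=> okc; apply: le_anti; rewrite /prob_returns prob_from_le1 prob_from_ev /=.
by apply: okc => s; [case: asbool | move=> /asboolT->].
Qed.

Lemma ok_skip env t s Q : Q s -> ok env Skip t.+1 s Q.
Proof. by move=> Qs phi b ge0 /(_ s Qs); rewrite /wp evS /= big_seq1 mul1r ev_halted. Qed.

Lemma ok_assign env x e t s (Q : store R -> Prop) :
  Q (upd s x (eval_expr s e)) -> ok env (Assign x e) t.+1 s Q.
Proof. by move=> Qs phi b ge0 /(_ _ Qs); rewrite /wp evS /= big_seq1 mul1r ev_halted. Qed.

Lemma ok_seq env c1 c2 t1 t2 t s Q1 Q2 : ((t1 + t2).+1 <= t)%N ->
  ok env c1 t1 s Q1 -> (forall s', Q1 s' -> ok env c2 t2 s' Q2) ->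
  ok env (Seq c1 c2) t s Q2.
Proof.
move=> tt ok1 ok2; apply: (ok_leq tt) => phi b ge0 le.
apply: le_trans (wp_seq _ _ _ _ _ _ ge0); apply: ok1 => s'.
  exact: wp_ge0.
by move=> /ok2; apply.
Qed.

Lemma ok_if env x c1 c2 t s Q : ok env (if truth (s x) then c1 else c2) t s Q ->
  ok env (If x c1 c2) t.+1 s Q.
Proof. by move=> okc phi b ge0 le; rewrite wp_if; apply: okc. Qed.

Lemma ok_call env x k y t s (P : val R -> Prop) (Q : store R -> Prop) :
  prob_returns [::] (nth Skip env k) (s y) t P = 1 ->
  (forall w, P w -> Q (upd s x w)) -> ok env (Call x k y) t.+2 s Q.
Proof.
move=> p1 PQ phi b ge0 le; apply: le_trans (wp_call _ _ _ _ _ _ ge0).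
by apply: ev_ok p1 _ _ => // s' /PQ; exact: le.
Qed.

Fixpoint block (l : seq (nat * expr)) : cmd :=
  if l is (x, e) :: l' then Seq (Assign x e) (block l') else Skip.

Fixpoint exec (l : seq (nat * expr)) s : store R :=
  if l is (x, e) :: l' then exec l' (upd s x (eval_expr s e)) else s.

Lemma ok_block env l t s (Q : store R -> Prop) : (2 * size l < t)%N ->
  Q (exec l s) -> ok env (block l) t s Q.
Proof.
elim: l t s => [|[x e] l IH] [|t] s // lt Qs; first exact: ok_skip.
have lt' : (2 * size l < t.-1)%N by move: lt => /=; lia.
apply: (ok_seq (t1 := 1) (t2 := t.-1) (Q1 := eq (upd s x (eval_expr s e)))).
- by move: lt' => /=; lia.
- exact: ok_assign.
by move=> _ <-; exact: IH.
Qed.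

Fixpoint rep (k : nat) c : cmd := if k is k'.+1 then Seq c (rep k' c) else Skip.

(** The invariant ties the store to a ghost list. Its processed part is kept in reverse, which is
    how a loop that conses builds its result. *)
Lemma ok_rep (A : Type) (inv : seq A -> seq A -> store R -> Prop) env c t ys s :
  (forall y done todo s', inv done (y :: todo) s' -> ok env c t s' (inv (y :: done) todo)) ->
  inv [::] ys s ->
  ok env (rep (size ys) c) (size ys * t.+1).+1 s (inv (rev ys) [::]).
Proof.
move=> step; rewrite /rev; elim: ys {1 2}[::] s => [|y ys IH] done s i.
  by apply: ok_skip.
apply: (ok_seq (t1 := t) (t2 := (size ys * t.+1).+1) _ (step _ _ _ _ i)).
  by rewrite /= mulSn; lia.
by move=> s'; apply: IH.
Qed.

Lemma ok_while (A : Type) (inv : seq A -> seq A -> store R -> Prop) env x c t ys s :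
  (forall done todo s', inv done todo s' -> truth (s' x) = (0 < size todo)%N) ->
  (forall y done todo s', inv done (y :: todo) s' -> ok env c t s' (inv (y :: done) todo)) ->
  inv [::] ys s ->
  ok env (While x c) (size ys * t.+1).+1 s (inv (rev ys) [::]).
Proof.
move=> guard step; rewrite /rev; elim: ys {1 2}[::] s => [|y ys IH] done s i phi b ge0 le.
  by rewrite wp_while_exit ?(guard _ _ _ i) //; exact: le.
rewrite [size _]/= mulSn addSn -addnS.
apply: le_trans (wp_while _ _ _ _ ge0 _); last by rewrite (guard _ _ _ i).
apply: (step _ _ _ _ i) => s'; first exact: wp_ge0.
by move=> /IH; apply.
Qed.
Lemma wp_seq_leq env c1 c2 t1 t2 t phi s (b : R) : (forall s', 0 <= phi s') ->
  ((t1 + t2).+1 <= t)%N -> b <= wp env c1 t1 (wp env c2 t2 phi) s ->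
  b <= wp env (Seq c1 c2) t phi s.
Proof.
move=> ge0 tt le; apply: (le_trans le); apply: le_trans (wp_seq _ _ _ _ _ _ ge0) _.
exact: wp_leq.
Qed.

Lemma wp_seq_ok env c1 c2 t1 t2 t phi s (b : R) Q : (forall s', 0 <= phi s') ->
  ((t1 + t2).+1 <= t)%N -> ok env c1 t1 s Q ->
  (forall s', Q s' -> b <= wp env c2 t2 phi s') -> b <= wp env (Seq c1 c2) t phi s.
Proof.
move=> ge0 tt ok1 le; apply: (wp_seq_leq ge0 tt); apply: ok1 le => s'; exact: wp_ge0.
Qed.

End ExpectedValue.
Arguments ev : simpl never.

(** * Straight-line code and vectors *)

Section Frames.
Variable R : realType.
Implicit Types (s : store R) (W : seq nat).

Definition modifies W s s' := forall y, y \notin W -> s' y = s y.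

Lemma modifies_trans W s1 s2 s3 : modifies W s1 s2 -> modifies W s2 s3 -> modifies W s1 s3.
Proof. by move=> f g y yW; rewrite g // f. Qed.

Lemma modifies_sub W W' s s' : all (mem W') W -> modifies W s s' -> modifies W' s s'.
Proof. by move=> /allP sub f y yW'; apply: f; apply: contra yW' => /sub. Qed.

Lemma modifies_exec W l s : all (mem W) (unzip1 l) -> modifies W s (exec l s).
Proof.
elim: l s => [|[x e] l IH] s //= /andP[xW lW] y yW; rewrite IH // /upd.
by case: eqP yW => // ->; rewrite xW.
Qed.

Lemma modifies_upd W x v s : x \in W -> modifies W s (upd s x v).
Proof. by move=> xW y; rewrite /upd; case: eqP => // ->; rewrite xW. Qed.

End Frames.

(* Registers below 20 are scratch; those from 20 on hold the state of the learner. *)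
Notation rA := 0%N (only parsing).
Notation rB := 1%N (only parsing).
Notation rZ := 2%N (only parsing).
Notation rW := 3%N (only parsing).
Notation rI := 4%N (only parsing).
Notation rV' := 5%N (only parsing).
Notation rF' := 6%N (only parsing).
Notation rY' := 7%N (only parsing).
Notation rLab := 10%N (only parsing).
Notation rC := 11%N (only parsing).
Notation rRev := 13%N (only parsing).
Notation rE := 14%N (only parsing).
Notation rK := 15%N (only parsing).
Notation rD' := 16%N (only parsing).
Notation rArg := 17%N (only parsing).
Notation rF := 18%N (only parsing).
Notation rV := 19%N (only parsing).
Notation rX := 20%N (only parsing).
Notation rH := 21%N (only parsing).
Notation rEta := 22%N (only parsing).
Notation rOne := 23%N (only parsing).
Notation rData := 24%N (only parsing).
Notation rAcc := 25%N (only parsing).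
Notation rY := 26%N (only parsing).
Notation rP := 27%N (only parsing).
Notation rSum := 28%N (only parsing).
Notation rD := 29%N (only parsing).
Notation rPass := 30%N (only parsing).
Notation rGo := 31%N (only parsing).
Notation rP0 := 32%N (only parsing).
Notation rTh := 33%N (only parsing).
Notation rGrow := 34%N (only parsing).
Notation rMore := 35%N (only parsing).

Definition numeral (x k : nat) : cmd :=
  Seq (Assign x ENil) (rep k (block [:: (x, EAdd x rOne)])).

Definition init_uniform (L : nat) : cmd :=
  Seq (numeral rZ L)
  (Seq (block [:: (rA, EDiv rOne rZ); (rV, ENil)])
       (rep L (block [:: (rV, ECons rA rV)]))).

(* Multiplicative weights: rV becomes proportional to rV * (1 - rEta * rF).  Each of the two
   passes reverses the list. *)
Definition update (L : nat) : cmd :=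
  Seq (block [:: (rW, ENil); (rZ, ENil)])
  (Seq (rep L (block [:: (rA, EHd rV); (rB, EHd rF); (rV, ETl rV); (rF, ETl rF);
                         (rB, EMul rEta rB); (rB, ESub rOne rB); (rA, EMul rA rB);
                         (rZ, EAdd rZ rA); (rW, ECons rA rW)]))
  (Seq (block [:: (rV, ENil)])
       (rep L (block [:: (rA, EHd rW); (rW, ETl rW); (rA, EDiv rA rZ);
                         (rV, ECons rA rV)])))).

(* rC becomes <rV, rF> minus the entry of rF at index rY. *)
Definition statistic (L : nat) : cmd :=
  Seq (block [:: (rC, ENil); (rV', EVar rV); (rF', EVar rF)])
  (Seq (rep L (block [:: (rA, EHd rV'); (rB, EHd rF'); (rV', ETl rV'); (rF', ETl rF');
                         (rA, EMul rA rB); (rC, EAdd rC rA)]))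
  (Seq (block [:: (rF', EVar rF); (rY', EVar rY)])
  (Seq (rep L (Seq (Assign rB (ELe rOne rY'))
                   (If rB (block [:: (rF', ETl rF'); (rY', ESub rY' rOne)]) Skip)))
       (block [:: (rA, EHd rF'); (rC, ESub rC rA)])))).

Section Vectors.
Variables (R : realType) (env : seq cmd).
Implicit Types (s : store R).

Definition enc_nums (l : seq R) : val R := enc_seq [seq Num a | a <- l].

Lemma numeralP x k s : x != rOne -> num (s rOne) = 1 ->
  ok env (numeral x k) (4 * k + 3) s
    (fun s' => num (s' x) = k%:R /\ modifies [:: x] s s').
Proof.
move=> xO one; pose s0 := upd s x (eval_expr s ENil).
apply: (ok_seq (t1 := 1) (t2 := (k * 4).+1) (Q1 := eq s0)); first lia.
  exact: ok_assign.
move=> _ <-; have := @ok_rep R nat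
  (fun done _ s' => num (s' x) = (size done)%:R /\ modifies [:: x] s s')
  env (block [:: (x, EAdd x rOne)]) 3 (iota 0 k) s0.
rewrite size_rev size_iota; apply.
  move=> k' done todo s' [nx fr]; apply: ok_block => //=; split.
    rewrite /upd eqxx /= nx fr ?one ?inE 1?eq_sym // natr1 //.
  by apply: modifies_trans fr _; apply: modifies_upd; rewrite inE.
split; first by rewrite /s0 /upd eqxx.
by apply: modifies_upd; rewrite inE.
Qed.

Lemma init_uniformP L s : num (s rOne) = 1 ->
  ok env (init_uniform L) (8 * L + 12) s
    (fun s' => s' rV = enc_nums (nseq L (L%:R)^-1) /\ modifies [:: rA; rZ; rV] s s').
Proof.
move=> one; apply: ok_seq (@numeralP rZ L s _ one) _ => //; last first.
  move=> s1 [Z1 fr1].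
  pose s2 := exec [:: (rA, EDiv rOne rZ); (rV, ENil)] s1.
  apply: (ok_seq (t1 := 5) (t2 := (L * 4).+1) (Q1 := eq s2)); [| exact: ok_block |].
    exact: leqnn.
  move=> _ <-; have := @ok_rep R nat
    (fun done _ s' => [/\ s' rV = enc_nums (nseq (size done) (L%:R)^-1),
       s' rA = Num (L%:R)^-1 & modifies [:: rA; rZ; rV] s s'])
    env (block [:: (rV, ECons rA rV)]) 3 (iota 0 L) s2.
  rewrite size_rev size_iota => H; apply: ok_imp (H _ _) _.
  - move=> k' done todo s' [V A fr]; apply: ok_block => //=; split.
    + by rewrite /upd /= A V.
    + by rewrite /upd /= A.
    + by apply: modifies_trans fr _; apply: modifies_upd.
  - split; first by [].
    + by rewrite /s2 /= /upd /= Z1 fr1 // one mul1r.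
    + by apply: (modifies_trans (modifies_sub _ fr1)) => //; exact: modifies_exec.
  by move=> s' [].
lia.
Qed.

Lemma updateP (I : Type) (ys : seq I) (v f : I -> R) eta s :
  s rV = enc_nums (map v ys) -> s rF = enc_nums (map f ys) ->
  num (s rEta) = eta -> num (s rOne) = 1 ->
  let w y := v y * (1 - eta * f y) in
  ok env (update (size ys)) (30 * size ys + 13) s
    (fun s' => s' rV = enc_nums [seq w y / \sum_(z <- ys) w z | y <- ys] /\
               modifies [:: rA; rB; rZ; rW; rV; rF] s s').
Proof.
move=> V F eta_ one w; set W := [:: rA; rB; rZ; rW; rV; rF].
rewrite /update; set l0 := [:: (rW, _); _].
apply: (ok_seq (t1 := 5) (t2 := 30 * size ys + 7) (Q1 := eq (exec l0 s))).
- lia.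
- exact: ok_block.
move=> _ <-; apply: (ok_seq (t1 := (size ys * 20).+1) (t2 := 10 * size ys + 5)).
- lia.
- apply: (ok_rep (inv := fun done todo s' => [/\ s' rV = enc_nums (map v todo),
     s' rF = enc_nums (map f todo), s' rW = enc_nums (map w done),
     num (s' rZ) = \sum_(z <- done) w z & modifies W s s'])).
    move=> y done todo s' [V' F' W' Z' fr]; apply: ok_block => //; split.
    + by rewrite /= /upd /= V'.
    + by rewrite /= /upd /= F'.
    + rewrite /= /upd /= W' V' F' /= /enc_nums /= /w.
      by rewrite (fr rEta isT) (fr rOne isT) eta_ one.
    + rewrite /= /upd /= Z' V' F' /= big_cons addrC /w.
      by rewrite (fr rEta isT) (fr rOne isT) eta_ one.
    + by apply: modifies_trans fr _; exact: modifies_exec.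
  by split; [| | | rewrite big_nil | exact: modifies_exec].
move=> s1 [V1 _ W1 Z1 fr1].
apply: (ok_seq (t1 := 3) (t2 := (size ys * 10).+1) (Q1 := eq (exec [:: (rV, ENil)] s1))).
- lia.
- exact: ok_block.
move=> _ <-; pose c := \sum_(z <- ys) w z; pose u y := w y / c.
have := ok_rep (env := env) (inv := fun done todo s' => [/\ s' rV = enc_nums (map u done),
  s' rW = enc_nums (map w todo), num (s' rZ) = c & modifies W s s'])
  (c := block [:: (rA, EHd rW); (rW, ETl rW); (rA, EDiv rA rZ); (rV, ECons rA rV)])
  (t := 9) (ys := rev ys) (s := exec [:: (rV, ENil)] s1).
rewrite size_rev revK => H; apply: ok_imp (H _ _) _.
- move=> y done todo s' [V' W' Z' fr]; apply: ok_block => //; split.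
  + by rewrite /= /upd /= V' W' /= Z'.
  + by rewrite /= /upd /= W'.
  + by rewrite /= /upd /= Z'.
  + by apply: modifies_trans fr _; exact: modifies_exec.
- split; [by [] | by [] | |].
  + by rewrite /= /upd /= Z1 big_rev.
  + by apply: modifies_trans fr1 _; exact: modifies_exec.
- by move=> s' [].
Qed.

Lemma statisticP (I : Type) (ys : seq I) (v f : I -> R) (j : nat) s :
  s rV = enc_nums (map v ys) -> s rF = enc_nums (map f ys) ->
  s rY = Num j%:R -> (j < size ys)%N -> num (s rOne) = 1 ->
  ok env (statistic (size ys)) (23 * size ys + 27) s
    (fun s' => num (s' rC) = \sum_(y <- ys) v y * f y - nth 0 (map f ys) j /\
               modifies [:: rA; rB; rV'; rF'; rY'; rC] s s').
Proof.
move=> V F Y js one; set W := [:: rA; rB; rV'; rF'; rY'; rC].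
rewrite /statistic; set l0 := [:: (rC, _); _; _].
apply: (ok_seq (t1 := 7) (t2 := 23 * size ys + 19) (Q1 := eq (exec l0 s))).
- lia.
- exact: ok_block.
move=> _ <-; apply: (ok_seq (t1 := (size ys * 14).+1) (t2 := 9 * size ys + 17)).
- lia.
- apply: (ok_rep (inv := fun done todo s' => [/\ s' rV' = enc_nums (map v todo),
     s' rF' = enc_nums (map f todo), num (s' rC) = \sum_(z <- done) v z * f z
     & modifies W s s'])).
    move=> y done todo s' [V' F' C' fr]; apply: ok_block => //; split.
    + by rewrite /= /upd /= V'.
    + by rewrite /= /upd /= F'.
    + by rewrite /= /upd /= C' V' F' /= big_cons addrC.
    + by apply: modifies_trans fr _; exact: modifies_exec.
  by split; [| | rewrite big_nil | exact: modifies_exec].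
move=> s1 [_ _ C1 fr1]; set l1 := [:: (rF', _); _].
apply: (ok_seq (t1 := 5) (t2 := 9 * size ys + 11) (Q1 := eq (exec l1 s1))).
- lia.
- exact: ok_block.
move=> _ <-; apply: (ok_seq (t1 := (size ys * 9).+1) (t2 := 5)).
- lia.
(* The loop always makes [size ys] passes, but its body is idle once [j] entries have been dropped;
   hence the [minn]. *)
- apply: (ok_rep (inv := fun done todo s' =>
     [/\ s' rF' = enc_nums (drop (minn j (size done)) (map f ys)),
         num (s' rY') = (j - minn j (size done))%:R,
         num (s' rC) = num (s1 rC) & modifies W s s'])).
    move=> y done todo s' [F' Y' C' fr].
    apply: (ok_seq (t1 := 1) (t2 := 6) (Q1 := eq (upd s' rB (eval_expr s' (ELe rOne rY'))))).
    + by [].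
    + exact: ok_assign.
    move=> _ <-; apply: ok_if.
    have -> : upd s' rB (eval_expr s' (ELe rOne rY')) rB = of_bool R (size done < j)%N.
      by rewrite /upd /= Y' (fr rOne isT) one ler1n subn_gt0; congr of_bool; lia.
    case: (boolP (size done < j)%N) => [lt|]; last first.
      rewrite -leqNgt => ge; apply: ok_skip.
      have ge' : (j <= size (y :: done))%N := leqW ge; rewrite (minn_idPl ge').
      move: F' Y'; rewrite (minn_idPl ge) => F' Y'.
      by split=> //; apply: modifies_trans fr _; exact: modifies_upd.
    move: F' Y'; rewrite (minn_idPr (ltnW lt)) => F' Y'.
    have lt' : (size (y :: done) <= j)%N := lt; apply: ok_block => //; rewrite (minn_idPr lt'); split.
    + by rewrite /= /upd /= F' -addn1 addnC -drop_drop; case: drop => //= *; rewrite drop0.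
    + by rewrite /= /upd /= Y' (fr rOne isT) one subnS -subn1 !natrB ?subn_gt0 // (ltnW lt).
    + by rewrite -C'.
    + apply: modifies_trans fr _.
      exact: (@modifies_exec _ _ [:: (rB, ELe rOne rY'); (rF', ETl rF'); (rY', ESub rY' rOne)]).
  split.
  + by rewrite minn0 drop0 /= /upd /= (fr1 rF isT).
  + by rewrite minn0 subn0 /= /upd /= (fr1 rY isT) Y.
  + by [].
  + by apply: modifies_trans fr1 _; exact: modifies_exec.
move=> s2 [F2 _ C2 fr2]; apply: ok_block => //; split; last first.
  by apply: modifies_trans fr2 _; exact: modifies_exec.
rewrite /= /upd /= C2 C1 big_rev; congr (_ - _).
rewrite F2 size_rev (minn_idPl (ltnW js)) (drop_nth 0) ?size_map //=.
Qed.

End Vectors.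

(* Reservoir sampling: the j-th label replaces the current one with probability
   v_j / (v_0 + ... + v_j), which leaves label j at the end with probability
   proportional to v_j. *)
Definition sample_step : cmd :=
  Seq (block [:: (rA, EHd rV'); (rV', ETl rV'); (rW, EAdd rW rA); (rB, EDiv rA rW)])
  (Seq (Flip rB rB)
  (Seq (If rB (Assign rLab (EVar rI)) Skip) (Assign rI (EAdd rI rOne)))).

Definition sample (L : nat) : cmd :=
  Seq (block [:: (rI, ESub rOne rOne); (rW, ENil); (rLab, ENil); (rV', EVar rV)])
      (rep L sample_step).

Section Sampling.
Variables (R : realType) (env : seq cmd) (L : nat).
Implicit Types (s : store R).
Let W := [:: rA; rB; rW; rI; rV'; rLab].

(** Reservoir invariant: the current label stands for the whole weight [w] read so far. Reading [y]
    hands the share [v y / (w + v y)] over to it, after which the label kept stands for [w + v y];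
    the mixture of the two outcomes is the left-hand side again. *)
Lemma sample_loopP (v : 'I_L -> R) (beta : val R -> R) phi ys i s :
  (forall s', 0 <= phi s') -> (forall y, 0 < v y) ->
  s rV' = enc_nums (map v ys) -> s rI = Num i%:R -> 0 <= num (s rW) ->
  map (@nat_of_ord L) ys = iota i (size ys) -> num (s rOne) = 1 ->
  (forall s', modifies W s s' -> beta (s' rLab) <= phi s') ->
  (num (s rW) * beta (s rLab) + \sum_(y <- ys) v y * beta (enc_label R y)) /
    (num (s rW) + \sum_(y <- ys) v y) <=
  wp env (rep (size ys) sample_step) (size ys * 17).+1 phi s.
Proof.
move=> ge0 v0; elim: ys i s => [|y ys IH] i s V I w0 yi one lephi.
  apply: (@ok_skip _ _ _ _ (eq s)) => // _ <-; rewrite !big_nil !addr0.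
  (* Without any weight the quotient is 0 by convention, and [phi] is nonnegative. *)
  have [->|nz] := eqVneq (num (s rW)) 0; first by rewrite invr0 mulr0.
  by rewrite mulrAC mulfV // mul1r; exact: lephi.
case: yi => yi ysi; rewrite [size _]/= mulSn [rep _ _]/= {1}/sample_step.
set l := [:: (rA, _); _; _; _].
apply: (@wp_seq_leq _ _ _ _ 16 (size ys * 17).+1) => //.
have wp0 s' : 0 <= wp env (rep (size ys) sample_step) (size ys * 17).+1 phi s'.
  exact: wp_ge0.
apply: (@wp_seq_ok _ _ _ _ 9 6 _ _ _ _ (eq (exec l s))) => //.
  exact: ok_block.
move=> _ <-; set s1 := exec l s; pose w := num (s rW).
have vy := v0 y; have wv0 : 0 < w + v y by rewrite ltr_wpDl.
have B1 : s1 rB = Num (v y / (w + v y)) by rewrite /s1 /= /upd /= V.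
have q01 : 0 <= num (s1 rB) <= 1.
  rewrite B1 /= divr_ge0 ?(ltW vy) ?(ltW wv0) //= ler_pdivrMr // mul1r.
  by rewrite lerDr.
apply: (@wp_seq_leq _ _ _ _ 1 4) => //.
rewrite wp_flip // B1 /=.
pose S := \sum_(z <- ys) v z; pose Sb := \sum_(z <- ys) v z * beta (enc_label R z).
have S0 : 0 <= S by apply: sumr_ge0 => z _; exact: ltW.
have tail (b : bool) : ((w + v y) * beta (if b then enc_label R y else s rLab) + Sb) /
    ((w + v y) + S) <= wp env (Seq (If rB (Assign rLab (EVar rI)) Skip)
      (Assign rI (EAdd rI rOne))) 4 (wp env (rep (size ys) sample_step) (size ys * 17).+1 phi)
      (upd s1 rB (of_bool R b)).
  have : ok env (Seq (If rB (Assign rLab (EVar rI)) Skip) (Assign rI (EAdd rI rOne))) 4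
    (upd s1 rB (of_bool R b)) (fun s' => [/\ s' rV' = enc_nums (map v ys),
      s' rI = Num i.+1%:R, num (s' rW) = w + v y,
      s' rLab = (if b then enc_label R y else s rLab) & modifies W s s']).
    pose s2 := if b then upd (upd s1 rB (of_bool R b)) rLab (s rI) else upd s1 rB (of_bool R b).
    apply: (@ok_seq _ _ _ _ 2 1 _ _ (eq s2)) => //.
      by apply: ok_if; rewrite /s2; case: (b) => /=; [exact: ok_assign | exact: ok_skip].
    move=> _ <-; apply: ok_assign; rewrite /s2 /s1; split.
    - by case: (b); rewrite /= /upd /= V.
    - by case: (b); rewrite /= /upd /= I one natr1.
    - by case: (b); rewrite /= /upd /= V.
    - by case: (b); rewrite /= /upd /= ?I /enc_label ?yi.
    - have f1 : modifies W s s1 by exact: modifies_exec.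
      have f2 : modifies W s s2.
        rewrite /s2; case: (b); repeat apply: (modifies_trans _ (modifies_upd _ _ _)) => //.
      exact: modifies_trans f2 (modifies_upd _ _ _).
  apply=> // s' [V' I' W' Lab' fr]; rewrite -Lab' -W'.
  apply: (IH i.+1) => //; first by rewrite W' ltW.
  - by rewrite (fr rOne isT).
  - by move=> s'' fr'; apply: lephi; exact: modifies_trans fr'.
apply: le_trans (lerD (ler_wpM2l _ (tail true)) (ler_wpM2l _ (tail false))).
- rewrite !big_cons -/S -/Sb -/w /= le_eqVlt; apply/orP; left; apply/eqP.
  have nz1 : w + v y != 0 by rewrite gt_eqF.
  have nz2 : w + v y + S != 0 by rewrite gt_eqF // ltr_wpDr.
  by rewrite addrA; field; rewrite nz1 nz2.
- by move: q01; rewrite B1 => /andP[].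
- by move: q01; rewrite B1 subr_ge0 => /andP[].
Qed.

Lemma sampleP (v : 'I_L -> R) (beta : val R -> R) phi s :
  (forall s', 0 <= phi s') -> (forall y, 0 < v y) -> \sum_y v y = 1 ->
  s rV = enc_nums (map v (enum 'I_L)) -> num (s rOne) = 1 ->
  (forall s', modifies W s s' -> beta (s' rLab) <= phi s') ->
  \sum_y v y * beta (enc_label R y) <= wp env (sample L) (17 * L + 11) phi s.
Proof.
move=> ge0 v0 v1 V one lephi; rewrite /sample; set l := [:: (rI, _); _; _; _].
have fr : modifies W s (exec l s) by exact: modifies_exec.
apply: (@wp_seq_ok _ _ _ _ 9 (L * 17).+1 _ _ _ _ (eq (exec l s))) => //.
- by lia.
- exact: ok_block.
move=> _ <-.
have := @sample_loopP v beta phi (enum 'I_L) 0 (exec l s) ge0 v0.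
rewrite size_enum_ord; have -> : num (exec l s rW) = 0 by rewrite /= /upd /=.
rewrite mul0r !add0r !big_enum /= v1 divr1; apply.
- by rewrite /= /upd /= V.
- by rewrite /= /upd /= subrr.
- by [].
- exact: val_enum_ord.
- by rewrite /= /upd /=.
- by move=> s' fr'; apply: lephi; exact: modifies_trans fr'.
Qed.

End Sampling.

(** * Evaluating the simulator *)

Definition apply_entry (L : nat) : cmd :=
  Seq (block [:: (rE, EHd rRev); (rRev, ETl rRev); (rK, EHd rE); (rD', ETl rE)])
  (Seq (If rK (Seq (Assign rArg (ECons rD' rV)) (Call rF 3 rArg))
              (Seq (Assign rArg (ECons rD' rX)) (Call rF 1 rArg)))
       (update L)).

(** Histories list the latest update first but are replayed from the oldest on, hence the initial
    reversal into [rRev]. *)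
Definition simulate (L : nat) : cmd :=
  Seq (block [:: (rRev, ENil); (rE, EVar rH)])
  (Seq (While rE (block [:: (rA, EHd rE); (rRev, ECons rA rRev); (rE, ETl rE)]))
  (Seq (init_uniform L) (While rRev (apply_entry L)))).

Section Simulator.
Variables (R : realType) (n L m T : nat).
Notation X := (n.-tuple bool).
Notation Delta := (fdist R 'I_L).
Notation vec := {ffun 'I_L -> R}.
Variables (A : distinguishing_oracle R n L m T) (B : calibration_oracle R L m T).
Variables (eta : R) (p0 : Delta).
Hypothesis eta01 : 0 <= eta < 1.

Lemma fdist_ge0 (I : finType) (p : fdist R I) i : 0 <= p i.
Proof. by case: p => p /= /andP[/forallP]. Qed.

Lemma fdist_sum1 (I : finType) (p : fdist R I) : \sum_i p i = 1.
Proof. by case: p => p /= /andP[_ /eqP]. Qed.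

Lemma fdist_labels_gt0 (p : Delta) : (0 < L)%N.
Proof.
case: L p => // p; have /eqP := fdist_sum1 p.
by rewrite big_ord0 eq_sym oner_eq0.
Qed.

(** An [fdist] carries a proof; the default [p] makes normalisation a total function, so that [sim]
    is defined on all histories, valid or not. *)
Definition dist_of (p : Delta) (w : vec) : Delta :=
  if pselect (exists q : Delta, q = w :> vec) is left ex then projT1 (cid ex) else p.

Lemma dist_ofE p (w : vec) :
  (forall y, 0 <= w y) -> \sum_y w y = 1 -> dist_of p w = w :> vec.
Proof.
move=> w0 w1; rewrite /dist_of; case: pselect => [ex|[]]; first by case: cid.
have H : [forall i, 0 <= w i] && (\sum_i w i == 1).
  by rewrite w1 eqxx andbT; apply/forallP.
by exists (FDist H).
Qed.

Definition uniform : Delta := dist_of p0 [ffun=> L%:R^-1].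

Lemma uniformE y : uniform y = L%:R^-1.
Proof.
have L0 := fdist_labels_gt0 p0; rewrite /uniform dist_ofE ?ffunE // => [z|].
  by rewrite ffunE invr_ge0.
under eq_bigr do rewrite ffunE.
by rewrite sumr_const card_ord -(mulr_natl L%:R^-1) mulfV // pnatr_eq0 -lt0n.
Qed.

Definition weight (p : Delta) (f : vec) y : R := p y * (1 - eta * f y).

Definition reweight (p : Delta) (f : vec) : Delta :=
  dist_of p [ffun y => weight p f y / \sum_z weight p f z].

Lemma weight_gt0 (p : Delta) (f : vec) y :
  -1 <= f y <= 1 -> 0 < p y -> 0 < weight p f y.
Proof.
move=> fb py; rewrite mulr_gt0 // subr_gt0; move: eta01 fb => /andP[e0 e1] /andP[_ f1].
by rewrite (le_lt_trans _ e1) // -[X in _ <= X]mulr1 ler_wpM2l.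
Qed.

Lemma sum_weight_gt0 (p : Delta) (f : vec) :
  (forall y, -1 <= f y <= 1) -> (forall y, 0 < p y) -> 0 < \sum_z weight p f z.
Proof.
move=> fb py; have L0 := fdist_labels_gt0 p.
rewrite (bigD1 (Ordinal L0)) //= ltr_pwDl ?weight_gt0 // sumr_ge0 // => z _.
by rewrite ltW // weight_gt0.
Qed.

Lemma reweightE (p : Delta) (f : vec) y :
  (forall y, -1 <= f y <= 1) -> (forall y, 0 < p y) ->
  reweight p f y = weight p f y / \sum_z weight p f z.
Proof.
move=> fb py; have Z0 := sum_weight_gt0 fb py.
rewrite /reweight dist_ofE ?ffunE // => [z|]; first by rewrite ffunE divr_ge0 ?ltW ?weight_gt0.
under eq_bigr do rewrite ffunE; by rewrite -mulr_suml mulfV // gt_eqF.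
Qed.

(* An update: the description [edesc] of a function returned by [A] ([ekind] is false) or by
   [B] ([ekind] is true), and this function, as a function of x and of the current s(x). *)
Record entry : Type :=
  Entry { ekind : bool; edesc : val R; efun : X -> Delta -> vec }.

Definition oracle (k : bool) : algorithm := if k then calib_alg B else dist_alg A.

Definition point (k : bool) (x : X) (v : Delta) : val R :=
  if k then enc_simplex v else enc_bits R x.

Definition entry_describes (e : entry) : Prop := forall x v,
  prob_returns [::] (evaluate (oracle (ekind e)))
    (Cons (edesc e) (point (ekind e) x v)) T (fun w => w = enc_vec (efun e x v)) = 1.

Definition entry_valid (e : entry) : Prop :=
  (forall x v y, -1 <= efun e x v y <= 1) /\ entry_describes e.

Fixpoint history_valid (h : seq entry) : Prop :=
  if h is e :: h' then entry_valid e /\ history_valid h' else True.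

Lemma history_valid_catrev h1 h2 :
  history_valid h1 -> history_valid h2 -> history_valid (catrev h1 h2).
Proof. by elim: h1 h2 => //= e h1 IH h2 [ve vh1] vh2; apply: IH. Qed.

Lemma history_valid_rev h : history_valid h -> history_valid (rev h).
Proof. by move=> vh; apply: history_valid_catrev. Qed.

Fixpoint sim (h : seq entry) (x : X) : Delta :=
  if h is e :: h' then reweight (sim h' x) (efun e x (sim h' x)) else uniform.

(** As [eta < 1], all factors [1 - eta * f] are positive. Strict positivity is what the reservoir
    sampler, the normalisation and the logarithm in [potential] rely on. *)
Lemma sim_gt0 h x y : history_valid h -> 0 < sim h x y.
Proof.
elim: h y => [|e h IH] y /=.
  by rewrite uniformE invr_gt0 ltr0n (fdist_labels_gt0 p0).
move=> [[eb _] vh]; rewrite reweightE // => [|z]; last exact: IH.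
by rewrite divr_gt0 ?weight_gt0 ?sum_weight_gt0 // => [|z]; exact: IH.
Qed.

Definition enc_entry (e : entry) : val R := Cons (of_bool R (ekind e)) (edesc e).

Definition enc_history (h : seq entry) : val R := enc_seq (map enc_entry h).

Lemma enc_vecE (v : vec) : enc_vec v = enc_nums (map v (enum 'I_L)).
Proof. by rewrite /enc_nums -map_comp. Qed.

Notation env := (subroutines A B).
Let W := [:: rA; rB; rZ; rW; rRev; rE; rK; rD'; rArg; rF; rV].

Definition time_simulate (q : nat) : nat := q.+1 * (30 * L + T + 38).

Lemma apply_entryP e h t x s : entry_valid e -> history_valid h ->
  s rRev = enc_history (e :: t) -> s rV = enc_vec (sim h x) -> s rX = enc_bits R x ->
  num (s rEta) = eta -> num (s rOne) = 1 ->
  ok env (apply_entry L) (30 * L + T + 29) s (fun s' =>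
    [/\ s' rRev = enc_history t, s' rV = enc_vec (sim (e :: h) x) & modifies W s s']).
Proof.
move=> [eb ed] vh rev_ V x_ eta_ one; rewrite /apply_entry; set l := [:: (rE, _); _; _; _].
apply: (@ok_seq _ _ _ _ 9 (30 * L + T + 19) _ _ (eq (exec l s))); first by lia.
  exact: ok_block.
move=> _ <-; set s1 := exec l s.
have f1 : modifies W s s1 by exact: modifies_exec.
have K1 : s1 rK = of_bool R (ekind e) by rewrite /s1 /= /upd /= rev_.
have D1 : s1 rD' = edesc e by rewrite /s1 /= /upd /= rev_.
have R1 : s1 rRev = enc_history t by rewrite /s1 /= /upd /= rev_.
apply: (@ok_seq _ _ _ _ (T.+2.+2.+1) (30 * L + 13) _ _ (fun s' =>
  [/\ s' rF = enc_vec (efun e x (sim h x)), s' rV = s rV, s' rRev = s1 rRev &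
      modifies W s s'])); first by lia.
  have call (k : nat) (y : nat) (v : val R) :
      nth Skip env k = evaluate (oracle (ekind e)) -> s1 y = v -> v = point (ekind e) x (sim h x) ->
    ok env (Seq (Assign rArg (ECons rD' y)) (Call rF k rArg)) T.+2.+2 s1 (fun s' =>
      [/\ s' rF = enc_vec (efun e x (sim h x)), s' rV = s rV, s' rRev = s1 rRev &
      modifies W s s']).
    move=> k_ y_ v_; pose s2 := upd s1 rArg (Cons (s1 rD') (s1 y)).
    apply: (@ok_seq _ _ _ _ 1 T.+2 _ _ (eq s2)); first by lia.
      exact: ok_assign.
    move=> _ <-; apply: (ok_call (P := fun w => w = enc_vec (efun e x (sim h x)))).
      by rewrite k_ /s2 {1}/upd eqxx D1 y_ v_; exact: ed.
    move=> _ ->; split=> //; apply: modifies_trans (modifies_upd _ _ _) => //.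
    exact: modifies_trans f1 (modifies_upd _ _ _).
  apply: ok_if; rewrite K1; case: (ekind e) call => /= call.
    by apply: (call 3%N) => //=; rewrite /s1 /= /upd /= V.
  by apply: (call 1%N) => //=; rewrite /s1 /= /upd /= x_.
move=> s2 [F2 V2 R2 f2].
have := @updateP R env _ (enum 'I_L) (sim h x) (efun e x (sim h x)) eta s2.
rewrite size_enum_ord V2 V -!enc_vecE (f2 rEta isT) (f2 rOne isT) => H.
apply: ok_imp (H _ _ _ _) _ => // s3 [V3 f3]; split.
- by rewrite f3 // R2.
- rewrite V3 enc_vecE; congr enc_nums; apply: eq_map => y; rewrite big_enum /=.
  by rewrite reweightE // => z; exact: sim_gt0.
- by apply: modifies_trans f2 (modifies_sub _ f3).
Qed.

Lemma simulateP h x s : history_valid h -> s rX = enc_bits R x -> s rH = enc_history h ->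
  num (s rEta) = eta -> num (s rOne) = 1 ->
  ok env (simulate L) (time_simulate (size h)) s (fun s' =>
    s' rV = enc_vec (sim h x) /\ modifies W s s').
Proof.
move=> vh x_ h_ eta_ one; rewrite /simulate; set l := [:: (rRev, _); _].
apply: (@ok_leq _ _ _ (8 * size h + 8 * L + 22 + size h * (30 * L + T + 30))).
  by rewrite /time_simulate; nia.
apply: (@ok_seq _ _ _ _ 5 (8 * size h + 8 * L + 16 + size h * (30 * L + T + 30)) _ _
  (eq (exec l s))); first by lia.
  exact: ok_block.
move=> _ <-; apply: (@ok_seq _ _ _ _ (size h * 8).+1
  (8 * L + 14 + size h * (30 * L + T + 30))); first by lia.
  apply: (ok_while (inv := fun done todo s' => [/\ s' rE = enc_history todo,
    s' rRev = enc_history done & modifies W s s'])).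
  - by move=> d [|e t] s' [-> _ _].
  - move=> e d t s' [E' R' f']; apply: ok_block => //; split.
    + by rewrite /= /upd /= E'.
    + by rewrite /= /upd /= E' R'.
    + by apply: modifies_trans f' _; exact: modifies_exec.
  - by split; [rewrite -h_ | | exact: modifies_exec].
move=> s1 [_ R1 f1].
apply: (@ok_seq _ _ _ _ (8 * L + 12) (size h * (30 * L + T + 30)).+1); first by lia.
  by apply: init_uniformP; rewrite (f1 rOne isT).
move=> s2 [V2 f2].
have f12 : modifies W s s2 by apply: modifies_trans f1 (modifies_sub _ f2).
(* As the replay starts with the oldest entry, the processed part [done] is itself a history with
   its latest entry first, and [sim done x] is the current vector. *)
have := ok_while (env := env) (x := rRev) (c := apply_entry L) (t := 30 * L + T + 29)
  (inv := fun done todo s' => [/\ s' rRev = enc_history todo, s' rV = enc_vec (sim done x),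
    history_valid done, history_valid todo & modifies W s s']) (ys := rev h) (s := s2).
rewrite revK size_rev -addnS => H; apply: ok_imp (H _ _ _) _.
- by move=> d [|e t] s' [->].
- move=> e d t s' [R' V' vd [ve vt] f'].
  apply: ok_imp (apply_entryP ve vd R' V' _ _ _) _;
    rewrite ?(f' rX isT) ?(f' rEta isT) ?(f' rOne isT) //.
  by move=> s'' [? ? f'']; split=> //; exact: modifies_trans f' f''.
- split=> //; [by rewrite (f2 rRev isT) | | exact: history_valid_rev].
  rewrite V2 enc_vecE; congr enc_nums; apply: (@eq_from_nth _ 0).
    by rewrite size_nseq size_map size_enum_ord.
  move=> i; rewrite size_nseq => iL.
  rewrite nth_nseq iL (nth_map (Ordinal iL)) ?size_enum_ord //.
  by rewrite uniformE.
- by move=> s' [].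
Qed.

(** The description stores [eta] next to the history, because evaluation does not receive [eps]. *)
Definition simulator_evaluate : cmd :=
  Seq (block [:: (rX, ETl 0); (rA, EHd 0); (rEta, EHd rA); (rH, ETl rA); (rOne, EOne)])
  (Seq (simulate L) (Assign 0 (EVar rV))).

Lemma simulator_evaluateP h x : history_valid h ->
  prob_returns env simulator_evaluate (Cons (Cons (Num eta) (enc_history h)) (enc_bits R x))
    (time_simulate (size h) + 14) (fun w => w = enc_vec (sim h x)) = 1.
Proof.
move=> vh; apply: ok_prob; rewrite /simulator_evaluate; set l := [:: (rX, _); _; _; _; _].
apply: (@ok_seq _ _ _ _ 11 (time_simulate (size h) + 2) _ _ (eq (exec l _))); first by lia.
  exact: ok_block.
move=> _ <-; apply: (@ok_seq _ _ _ _ (time_simulate (size h)) 1); first by lia.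
  exact: (simulateP vh).
by move=> s' [V' _]; exact: ok_assign.
Qed.

End Simulator.

(** * The learner *)

Definition read_point : cmd :=
  block [:: (rA, EHd rData); (rData, ETl rData); (rX, EHd rA); (rY, ETl rA)].

Definition point_register (k : bool) : nat := if k then rV else rX.

Definition draw_step (L : nat) (k : bool) : cmd :=
  Seq read_point (Seq (simulate L) (Seq (sample L)
    (block [:: (rA, ECons rLab rY); (rA, ECons (point_register k) rA);
               (rAcc, ECons rA rAcc)]))).

Definition test_step (L : nat) (k : bool) : cmd :=
  Seq read_point (Seq (simulate L) (Seq (block [:: (rArg, ECons rD (point_register k))])
    (Seq (Call rF (if k then 3 else 1)%N rArg) (Seq (statistic L)
      (block [:: (rC, ESub rC rTh); (rSum, EAdd rSum rC); (rP, EMul rP rGrow);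
                 (rMore, ELe rP rOne)]))))).

(* One oracle call on [m] points, followed by a test of its answer on fresh points.  The
   length of the test is controlled by rP, which grows geometrically from rP0 to 1. *)
Definition attempt (L m : nat) (k : bool) : cmd :=
  Seq (block [:: (rAcc, ENil)])
  (Seq (rep m (draw_step L k))
  (Seq (Call rD (if k then 2 else 0)%N rAcc)
  (Seq (block [:: (rP, EVar rP0); (rSum, ENil); (rMore, ELe rP rOne)])
  (Seq (While rMore (test_step L k))
  (Seq (block [:: (rA, ENil); (rB, ELe rA rSum)])
    (If rB (block [:: (rA, if k then EOne else ENil); (rA, ECons rA rD);
                      (rH, ECons rA rH); (rPass, EOne)]) Skip)))))).

(** The guard [rGo] becomes [Nil] if both attempts fail and a copy of [rData] otherwise, so the loop
    also ends when the data are exhausted. The second attempt is made in either case, with the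
    function updated by the first one if that passed. *)
Definition round (L m : nat) : cmd :=
  Seq (block [:: (rPass, ENil)])
  (Seq (attempt L m false)
  (Seq (attempt L m true)
    (If rPass (Assign rGo (EVar rData)) (Assign rGo ENil)))).

Section Learner.
Variables (R : realType) (n L m T M : nat).
Notation X := (n.-tuple bool).
Notation Delta := (fdist R 'I_L).
Notation vec := {ffun 'I_L -> R}.
Variables (A : distinguishing_oracle R n L m T) (B : calibration_oracle R L m T).
Variables (eta th grow start : R) (p0 : Delta).
Hypothesis eta01 : 0 <= eta < 1.
Hypothesis M_gt0 : (0 < M)%N.
(** Since [rP] is multiplied by [grow] after each point, this says that the guard [rMore] lets
    exactly [M] points through. *)
Hypothesis test_length : forall i, (i <= M)%N -> (start * grow ^+ i <= 1) = (i < M)%N.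

Notation env := (subroutines A B).
Notation sim := (sim eta p0).
Notation entry := (entry R n L).
Notation oracle := (oracle A B).
Notation entry_valid := (entry_valid A B).
Notation history_valid := (history_valid A B).
Notation data := (seq (X * 'I_L)).
Implicit Types (h : seq entry) (l : data) (s : store R).

Definition enc_point (p : X * 'I_L) : val R := Cons (enc_bits R p.1) (enc_label R p.2).

Definition enc_points l : val R := enc_seq (map enc_point l).

Definition sampled k h (p : X * 'I_L) (lab : val R) : val R :=
  Cons (point k p.1 (sim h p.1)) (Cons lab (enc_label R p.2)).

(* Mean of [gamma acc' l'], where [acc'] extends [acc] by [c] points taken from [l], with labels
   drawn from [sim h], and [l'] is the rest of [l]. *)
Fixpoint draw k h c l acc (gamma : val R -> data -> R) : R :=
  if c is c'.+1 then
    if l is p :: l' then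
      \sum_y sim h p.1 y * draw k h c' l' (Cons (sampled k h p (enc_label R y)) acc) gamma
    else 0
  else gamma acc l.

Definition output_mean k v (psi : val R -> R) : R :=
  ev T (init [::] (learn (oracle k)) v) (fun s => psi (s 0)).

(** Unbiased estimate of the gain: the mean under the simulated distribution is computed exactly,
    and the mean under gstar is replaced by the value at the observed label. *)
Definition stat (e : entry) h (p : X * 'I_L) : R :=
  let v := sim h p.1 in \sum_y v y * efun e p.1 v y - efun e p.1 v p.2.

Definition passes e h l : bool := 0 <= \sum_(p <- l) (stat e h p - th).

(** The program holds a description only, whereas the analysis needs the function described. One is
    chosen here, and by [entry_describes_inj] the choice is immaterial. An output that describes no
    bounded function counts as 0. *)
Definition tested k h l (beta : bool -> seq entry -> data -> R) (d : val R) : R :=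
  if pselect (exists F, entry_valid (Entry k d F)) is left ex then
    let e := Entry k d (projT1 (cid ex)) in
    if passes e h (take M l) then beta true (e :: h) (drop M l) else beta false h (drop M l)
  else 0.

Definition attempt_mean k h l beta : R :=
  draw k h m l Nil (fun acc l' => output_mean k acc (tested k h l' beta)).

(* Mean of [fin] at the final history, after at most [r] rounds on the data [l]. *)
Fixpoint process (fin : seq entry -> R) r h l : R :=
  if r is r'.+1 then
    attempt_mean false h l (fun pass1 h1 l1 =>
      attempt_mean true h1 l1 (fun pass2 h2 l2 =>
        if pass1 || pass2 then process fin r' h2 l2 else fin h2))
  else fin h.

Definition constants s : Prop :=
  [/\ s rEta = Num eta, num (s rOne) = 1, num (s rP0) = start, num (s rTh) = th
    & num (s rGrow) = grow].

Definition learner_state h l s : Prop :=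
  [/\ s rH = enc_history h, s rData = enc_points l & constants s].

Let W0 := iota 0 20.
Let Wpoint := iota 0 21 ++ [:: rData; rAcc; rY].
Let Wtest := iota 0 21 ++ [:: rData; rY; rP; rSum; rMore].
Let Wattempt := iota 0 22 ++ [:: rData; rAcc; rY; rP; rSum; rD; rPass; rMore].

Lemma constants_modifies W s s' : modifies W s s' ->
  all (fun x => x \notin W) [:: rEta; rOne; rP0; rTh; rGrow] -> constants s -> constants s'.
Proof.
move=> mod /and5P[w1 w2 w3 w4 /andP[w5 _]] [? ? ? ? ?].
by split; rewrite mod.
Qed.

Section Attempt.
Variables (k : bool) (q : nat).
Let tsim := time_simulate L T q.

(** Stated with an arbitrary continuation [c], since drawing and testing begin in the same way. *)
Lemma read_simulateP h p l s : history_valid h -> (size h <= q)%N -> learner_state h (p :: l) s ->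
  forall c t phi (b : R), (forall s', 0 <= phi s') ->
  (forall s', learner_state h l s' -> s' rV = enc_vec (sim h p.1) -> s' rX = enc_bits R p.1 ->
     s' rY = enc_label R p.2 -> modifies (iota 0 21 ++ [:: rData; rY]) s s' ->
     b <= wp env c t phi s') ->
  b <= wp env (Seq read_point (Seq (simulate L) c)) (tsim + t + 11) phi s.
Proof.
move=> vh hq [H D cs] c t phi b ge0 le; rewrite /read_point; set rd := [:: (rA, _); _; _; _].
apply: (@wp_seq_ok _ _ _ _ 9 (tsim + t).+1 _ _ _ _ (eq (exec rd s))) => //; first lia.
  exact: ok_block.
move=> _ <-; set s1 := exec rd s.
have f1 : modifies (iota 0 21 ++ [:: rData; rY]) s s1 by exact: modifies_exec.
have cs1 : constants s1 by exact: constants_modifies f1 _ cs.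
have X1 : s1 rX = enc_bits R p.1 by rewrite /s1 /= /upd /= D.
apply: (@wp_seq_ok _ _ _ _ tsim t _ _ _ _ (fun s' =>
    s' rV = enc_vec (sim h p.1) /\ modifies W0 s1 s')) => //.
  apply: (@ok_leq _ _ _ (time_simulate L T (size h))).
    by rewrite /tsim /time_simulate leq_mul2r ltnS hq orbT.
  have [E1 O1 _ _ _] := cs1.
  apply: ok_imp (simulateP (p0 := p0) eta01 vh X1 _ _ O1) _.
  - by rewrite (f1 rH isT).
  - by rewrite E1.
  - by move=> s' [? f]; split=> //; exact: modifies_sub f.
move=> s2 [V2 f2].
have f12 : modifies (iota 0 21 ++ [:: rData; rY]) s s2.
  by apply: modifies_trans f1 (modifies_sub _ f2).
apply: le => //.
- split; first by rewrite (f12 rH isT).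
  + by rewrite (f2 rData isT) /s1 /= /upd /= D.
  + exact: constants_modifies f12 _ cs.
- by rewrite (f2 rX isT).
- by rewrite (f2 rY isT) /s1 /= /upd /= D.
Qed.

Lemma drawP h c l acc s phi gamma : history_valid h -> (size h <= q)%N -> (c <= size l)%N ->
  learner_state h l s -> s rAcc = acc -> (forall s', 0 <= phi s') ->
  (forall s', learner_state h (drop c l) s' -> modifies Wpoint s s' ->
     gamma (s' rAcc) (drop c l) <= phi s') ->
  draw k h c l acc gamma <=
  wp env (rep c (draw_step L k)) (c * (tsim + 17 * L + 31)).+1 phi s.
Proof.
move=> vh hq; elim: c l acc s phi => [|c IH] [|p l] acc s phi // cl st Acc ge0 le.
- by apply: (@ok_skip _ _ _ _ (eq s)) => // _ <-; rewrite /= -Acc; exact: le.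
- by apply: (@ok_skip _ _ _ _ (eq s)) => // _ <-; rewrite /= -Acc; exact: le.
set t := (c * (tsim + 17 * L + 31)).+1.
have wp0 s' : 0 <= wp env (rep c (draw_step L k)) t phi s' by exact: wp_ge0.
apply: (@wp_seq_leq _ _ _ _ (tsim + (17 * L + 19) + 11) t) => //.
  by rewrite /t mulSn; lia.
apply: (read_simulateP vh hq st wp0) => s1 st1 V1 X1 Y1 f1.
apply: (@wp_seq_leq _ _ _ _ (17 * L + 11) 7) => //; first lia.
(* The mean of all remaining draws, as a function of the label about to be drawn, is the payoff to
   which [sampleP] is applied. *)
pose beta lab := draw k h c l (Cons (sampled k h p lab) acc) gamma.
have [_ _ [_ one1 _ _ _]] := st1.
rewrite enc_vecE in V1.
apply: (@sampleP _ _ _ _ beta _ _ _ _ _ V1 one1) => [s'|y||].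
- exact: wp_ge0.
- by apply: (sim_gt0 (A := A) (B := B)).
- exact: fdist_sum1.
move=> s2 f2; set bl := [:: (rA, _); _; _].
apply: (@ok_block _ _ bl 7 s2 (eq (exec bl s2))) => // _ <-.
set s3 := exec bl s2.
have f13 : modifies Wpoint s1 s3.
  by apply: modifies_trans (modifies_sub _ f2) (modifies_exec _ _).
have f3 : modifies Wpoint s s3 by apply: modifies_trans (modifies_sub _ f1) f13.
have f23 : modifies [:: rA; rAcc] s2 s3 by exact: modifies_exec.
apply: IH => //.
- case: st1 => H1 D1 cs1; split.
  + by rewrite (f13 rH isT).
  + by rewrite (f23 rData isT) (f2 rData isT).
  + exact: constants_modifies f13 _ cs1.
- rewrite /s3 /= /upd /= (f2 rAcc isT) (f1 rAcc isT) Acc (f2 rY isT) Y1 /sampled.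
  congr (Cons (Cons _ _) _); rewrite /point_register /point; case: (k) => /=.
    by rewrite (f2 rV isT) V1 -enc_vecE.
  by rewrite (f2 rX isT).
- by move=> s' st' f'; apply: le => //; exact: modifies_trans f3 f'.
Qed.

(** Evaluating a valid entry gives the right value with probability 1, so the outcome of a test is
    determined by its data and [ok] can describe it. *)
Lemma testP e h l s : entry_valid e -> ekind e = k -> history_valid h -> (size h <= q)%N ->
  (M <= size l)%N -> learner_state h l s -> s rD = edesc e -> num (s rP) = start ->
  num (s rSum) = 0 -> s rMore = of_bool R true ->
  ok env (While rMore (test_step L k)) (M * (tsim + T + 23 * L + 56)).+1 s (fun s' =>
    [/\ learner_state h (drop M l) s',
        num (s' rSum) = \sum_(p <- take M l) (stat e h p - th) & modifies Wtest s s']).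
Proof.
move=> [eb ed] ek vh hq Ml [H D cs] D_ P_ S_ More_.
have sz : size (take M l) = M by rewrite size_takel.
have := ok_while (env := env) (x := rMore) (c := test_step L k) (t := tsim + T + 23 * L + 55)
  (inv := fun (done todo : data) s' => [/\ s' rData = enc_points (todo ++ drop M l),
    num (s' rSum) = \sum_(p <- done) (stat e h p - th),
    num (s' rP) = start * grow ^+ size done /\ (size done + size todo)%N = M,
    s' rMore = of_bool R (num (s' rP) <= 1) & modifies Wtest s s'])
  (ys := take M l) (s := s).
rewrite sz -addnS => H0; apply: ok_imp (H0 _ _ _) _.
- move=> d t s' [_ _ [-> dt] -> _]; rewrite test_length; last by rewrite -dt leq_addr.
  by rewrite -dt -[X in (X < _)%N]addn0 ltn_add2l; case: (0 < size t)%N.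
- move=> p d t s' [D' S' [P' dt] M' f'] phi b ge0 le.
  have st' : learner_state h (p :: (t ++ drop M l)) s'.
    by split=> //; [rewrite (f' rH isT) | exact: constants_modifies f' _ cs].
  have -> : (tsim + T + 23 * L + 55 = tsim + (T + 23 * L + 44) + 11)%N by lia.
  apply: (read_simulateP vh hq st' ge0) => s1 [H1 D1 cs1] V1 X1 Y1 f1.
  set s2 := upd s1 rArg (Cons (s1 rD) (s1 (point_register k))).
  apply: (@wp_seq_ok _ _ _ _ 3 (T + 23 * L + 40) _ _ _ _ (eq s2)) => //; first lia.
    exact: ok_block.
  move=> _ <-; pose s3 := upd s2 rF (enc_vec (efun e p.1 (sim h p.1))).
  apply: (@wp_seq_ok _ _ _ _ T.+2 (23 * L + 37) _ _ _ _ (eq s3)) => //; first lia.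
    apply: (ok_call (P := fun w => w = enc_vec (efun e p.1 (sim h p.1)))); last by move=> _ ->.
    rewrite -(ed p.1 (sim h p.1)) ek; congr prob_returns; first by case: (k).
    rewrite /s2 {1}/upd eqxx (f1 rD isT) (f' rD isT) D_; congr Cons.
    by rewrite /point_register; case: (k); rewrite ?V1 ?X1.
  move=> _ <-; have [E1 O1 P1 T1 G1] := cs1.
  have f3 : modifies Wtest s s3.
    apply: modifies_trans f' _; apply: modifies_trans (modifies_sub _ f1) _ => //.
    exact: modifies_trans (modifies_upd _ _ _) (modifies_upd _ _ _).
  have := @statisticP R env _ (enum 'I_L) (sim h p.1) (efun e p.1 (sim h p.1)) p.2 s3.
  rewrite size_enum_ord -!enc_vecE => H1'.
  apply: (@wp_seq_ok _ _ _ _ (23 * L + 27) 9 _ _ _ _ _ ge0 _ (H1' _ _ _ _ _)) => //.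
    by lia.
  move=> s4 [C4 f4]; set bl := [:: (rC, _); _; _; _].
  apply: (@ok_block _ _ bl 9 s4 (eq (exec bl s4))) => // _ <-; apply: le.
  have f34 : modifies Wtest s3 s4 by exact: modifies_sub f4.
  split.
  + by rewrite /= /upd /= (f4 rData isT) /s3 /s2 /upd /= D1.
  + rewrite /= /upd /= big_cons [RHS]addrC /stat (f4 rSum isT) (f4 rTh isT) /s3 /s2 /upd /= T1.
    rewrite (f1 rSum isT) S' C4 big_enum /=; congr (_ + (_ - _ - _)).
    rewrite (nth_map p.2) ?size_enum_ord ?ltn_ord //; congr (efun _ _ _ _).
    by rewrite nth_ord_enum.
  + split; last by rewrite -dt addnS.
    rewrite /= /upd /= (f4 rP isT) (f4 rGrow isT) /s3 /s2 /upd /= (f1 rP isT) P' G1.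
    by rewrite -mulrA -exprSr.
  + by rewrite /= /upd /= (f4 rOne isT) /s3 /s2 /upd /= O1.
  + by apply: modifies_trans f3 (modifies_trans f34 (modifies_exec _ _)).
- split=> //; rewrite ?big_nil ?cat_take_drop //.
  + by rewrite P_ expr0 mulr1.
  + by rewrite P_ More_ -[start]mulr1 -(expr0 grow) test_length // M_gt0.
move=> s' [D' S' _ _ f']; split=> //; last by rewrite S' big_rev.
by split=> //; [rewrite (f' rH isT) | exact: constants_modifies f' _ cs].
Qed.

Definition time_attempt : nat :=
  m * (tsim + 17 * L + 31) + M * (tsim + T + 23 * L + 56) + T + 40.

Lemma attemptP h l s phi beta : history_valid h -> (size h <= q)%N -> (m + M <= size l)%N ->
  learner_state h l s -> (forall s', 0 <= phi s') ->
  (forall e s', entry_valid e -> learner_state (e :: h) (drop M (drop m l)) s' ->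
     modifies Wattempt s s' -> truth (s' rPass) ->
     beta true (e :: h) (drop M (drop m l)) <= phi s') ->
  (forall s', learner_state h (drop M (drop m l)) s' ->
     modifies Wattempt s s' -> s' rPass = s rPass ->
     beta false h (drop M (drop m l)) <= phi s') ->
  attempt_mean k h l beta <= wp env (attempt L m k) time_attempt phi s.
Proof.
move=> vh hq ml [H D cs] ge0 leT leF; rewrite /attempt.
set t1 := (m * (tsim + 17 * L + 31)).+1; set t2 := (M * (tsim + T + 23 * L + 56)).+1.
have tE : (time_attempt = t1 + t2 + T + 38)%N by rewrite /time_attempt /t1 /t2; lia.
pose s0 := upd s rAcc Nil.
apply: (@wp_seq_ok _ _ _ _ 3 (t1 + t2 + T + 34) _ _ _ _ (eq s0)) => //; first lia.
  exact: ok_block.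
move=> _ <-.
apply: (@wp_seq_leq _ _ _ _ t1 (t2 + T + 33)) => //; first lia.
apply: drawP => //; first by apply: leq_trans ml; rewrite leq_addr.
  by move=> s'; exact: wp_ge0.
move=> s1 [H1 D1 cs1] f1.
have f01 : modifies Wattempt s s1.
  by apply: modifies_trans (modifies_sub _ f1) => //; exact: modifies_upd.
apply: (@wp_seq_leq _ _ _ _ T.+2 (t2 + 30)) => //; first lia.
apply: le_trans (wp_call _ _ _ _ _ _ _); last by move=> s'; exact: wp_ge0.
have -> : nth Skip env (if k then 2 else 0)%N = learn (oracle k) by case: (k).
(* If the output describes no bounded function, the left-hand side is 0 and the rest of the run is
   irrelevant. *)
apply: le_ev => so; set d := so 0; rewrite /tested; case: pselect => [ex|_]; last exact: wp_ge0.
case: cid => F ve; rewrite [projT1 _]/=; set e := Entry _ _ _.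
pose s2 := upd s1 rD d; set bl := [:: (rP, _); _; _].
have f2 : modifies Wattempt s s2 by apply: modifies_trans f01 (modifies_upd _ _ _).
pose s3 := exec bl s2.
have f3 : modifies Wattempt s s3 by apply: modifies_trans f2 (modifies_exec _ _).
apply: (@wp_seq_ok _ _ _ _ 7 (t2 + 22) _ _ _ _ (eq s3)) => //; first lia.
  exact: ok_block.
move=> _ <-.
have [_ O1 P1 _ _] := cs1.
have st3 : learner_state h (drop m l) s3.
  split; [by rewrite /s3 /= /upd /= /s2 /upd /= H1 | by rewrite /s3 /= /upd /= /s2 /upd /= D1 |].
  exact: constants_modifies f3 _ cs.
apply: (@wp_seq_ok _ _ _ _ t2 21 _ _ _ _ _ ge0 _ (testP ve _ vh hq _ st3 _ _ _ _)) => //.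
- lia.
- by rewrite size_drop leq_subRL // (leq_trans _ ml) // leq_addr.
- by rewrite /s3 /= /upd /= /s2 /upd /= O1 P1 -[start]mulr1 -(expr0 grow) test_length // M_gt0.
move=> s4 [[H4 D4 cs4] S4 f4].
have f04 : modifies Wattempt s s4 by apply: modifies_trans f3 (modifies_sub _ f4).
pose s5 := exec [:: (rA, ENil); (rB, ELe rA rSum)] s4.
have f5 : modifies Wattempt s s5 by apply: modifies_trans f04 (modifies_exec _ _).
apply: (@wp_seq_ok _ _ _ _ 5 10 _ _ _ _ (eq s5)) => //.
  exact: ok_block.
move=> _ <-; rewrite wp_if.
have -> : s5 rB = of_bool R (passes e h (take M (drop m l))).
  by rewrite /s5 /= /upd /= S4.
case: (passes e h _); last first.
  apply: (@ok_skip _ _ _ _ (eq s5)) => // _ <-; apply: leF => //.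
  rewrite /s5 /= /upd /= (f4 rPass isT) /s3 /= /upd /= /s2 /upd /= (f1 rPass isT) //.
set b2 := [:: (rA, _); _; _; _].
apply: (@ok_block _ _ b2 9 s5 (eq (exec b2 s5))) => // _ <-.
have f6 : modifies Wattempt s (exec b2 s5) by apply: modifies_trans f5 (modifies_exec _ _).
apply: (leT e) => //; split.
- rewrite /= /upd /= /s5 /= /upd /= H4 (f4 rD isT) /s3 /= /upd /= /s2 /upd /=.
  by rewrite /enc_history /= /enc_entry /=; case: (k).
- by rewrite /= /upd /= /s5 /= /upd /= D4.
- exact: constants_modifies f6 _ cs.
Qed.

End Attempt.

(** A round adds at most two entries, so [q] bounds all histories to come and the time per round is
    uniform. The data suffice for exactly [r] rounds: they are empty, and the guard fails, just when
    [process] has no round left. *)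
Lemma roundsP fin q r h l s phi : history_valid h -> (size h + 2 * r <= q)%N ->
  size l = (r * (2 * (m + M)))%N -> learner_state h l s -> s rGo = s rData ->
  (forall s', 0 <= phi s') ->
  (forall s' h', history_valid h' -> (size h' <= size h + 2 * r)%N ->
     s' rH = enc_history h' -> s' rEta = Num eta -> fin h' <= phi s') ->
  process fin r h l <=
  wp env (While rGo (round L m)) (r * (2 * time_attempt q + 9)).+1 phi s.
Proof.
move=> + + + + + ge0; elim: r h l s => [|r IH] h l s vh hq sl st go le.
  case: l sl st => // _ [H D [E _ _ _ _]]; rewrite wp_while_exit ?go ?D //.
  by apply: le; rewrite ?addn0.
set ta := time_attempt q; set t2 := (r * (2 * ta + 9)).+1.
have -> : ((r.+1 * (2 * ta + 9)).+1 = (2 * ta + 8 + t2).+1)%N by rewrite /t2 mulSn; lia.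
apply: le_trans (wp_while _ _ _ _ ge0 _); last first.
  by case: st => _ D _; rewrite go D; case: (l) sl => //; move: M_gt0; rewrite mulSn /=; lia.
set psi := wp _ _ t2 phi; have psi0 s' : 0 <= psi s' by exact: wp_ge0.
have finish p h2 l2 s2 : history_valid h2 -> (size h2 <= size h + 2)%N ->
    size l2 = (r * (2 * (m + M)))%N -> learner_state h2 l2 s2 -> truth (s2 rPass) = p ->
    (if p then process fin r h2 l2 else fin h2) <=
    wp env (If rPass (Assign rGo (EVar rData)) (Assign rGo ENil)) 2 psi s2.
  move=> vh2 sh2 sl2 st2 <-; rewrite wp_if; case: (truth _).
    apply: (@ok_assign _ _ _ _ _ _ (eq _)) => // _ <-.
    apply: IH => //; first lia.
    by move=> s' h' vh' sh'; apply: le => //; lia.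
  apply: (@ok_assign _ _ _ _ _ _ (eq _)) => // _ <-; rewrite /psi wp_while_exit //.
  by case: st2 => H2 _ [E2 _ _ _ _]; apply: le => //; lia.
set s0 := upd s rPass Nil.
have st0 : learner_state h l s0 by case: st.
apply: (@wp_seq_ok _ _ _ _ 3 (2 * ta + 4) _ _ _ _ (eq s0)) => //; first lia.
  exact: ok_block.
move=> _ <-; apply: (@wp_seq_leq _ _ _ _ ta (ta + 3)) => //; first lia.
have second p h1 s1 : history_valid h1 -> (size h1 <= size h + 1)%N ->
    learner_state h1 (drop M (drop m l)) s1 -> truth (s1 rPass) = p ->
    attempt_mean true h1 (drop M (drop m l)) (fun pass2 h2 l2 =>
      if p || pass2 then process fin r h2 l2 else fin h2) <=
    wp env (Seq (attempt L m true) (If rPass (Assign rGo (EVar rData)) (Assign rGo ENil)))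
      (ta + 3) psi s1.
  move=> vh1 sh1 st1 p1; apply: (@wp_seq_leq _ _ _ _ ta 2) => //; first lia.
  apply: attemptP => //.
  - by lia.
  - by rewrite !size_drop sl; nia.
  - by move=> s'; exact: wp_ge0.
  - move=> e s2 ve st2 _ p2; rewrite orbT; apply: (finish true) => //=; first lia.
    by rewrite !size_drop sl; nia.
  - move=> s2 st2 _ p2; rewrite orbF; apply: finish => //; first lia.
      by rewrite !size_drop sl; nia.
    by rewrite p2.
apply: attemptP => //.
- by lia.
- by rewrite sl; nia.
- by move=> s'; exact: wp_ge0.
- by move=> e s1 ve st1 _ p1; apply: (second true) => //=; lia.
- by move=> s1 st1 _ p1; apply: (second false) => //; [lia | rewrite p1].
Qed.

End Learner.

(** All parameters are made from 1, [eps] and [delta]: [eta] by halving [eps] three times, the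
    threshold as [6 * eta], and the growth factor as [1 + eta ^+ 2 / 8]. The number [132 * L] is
    counted up in unary; the starting value of [rP] involves [L] where the error budget would only
    ask for [ln L]. *)
Definition simulator_learn (L m : nat) : cmd :=
  Seq (block [:: (rX, EVar 0); (rOne, EOne); (rSum, EHd rX); (rX, ETl rX); (rD, EHd rX);
                 (rData, ETl rX); (rGo, EVar rData); (rH, ENil)])
  (Seq (numeral rB (132 * L))
  (Seq (block [:: (rA, EAdd rOne rOne);
                  (rEta, EDiv rSum rA); (rEta, EDiv rEta rA); (rEta, EDiv rEta rA);
                  (rTh, EAdd rEta rEta); (rY, EAdd rTh rTh); (rTh, EAdd rTh rY);
                  (rGrow, EMul rEta rEta); (rGrow, EDiv rGrow rA); (rGrow, EDiv rGrow rA);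
                  (rGrow, EDiv rGrow rA); (rGrow, EAdd rOne rGrow);
                  (rP0, EMul rSum rSum); (rP0, EMul rD rP0); (rP0, EDiv rP0 rB)])
  (Seq (While rGo (round L m)) (Assign 0 (ECons rEta rH))))).

Section LearnerCorrectness.
Variables (R : realType) (n L m T M : nat).
Variables (A : distinguishing_oracle R n L m T) (B : calibration_oracle R L m T).
Variables (eps delta : R) (p0 : fdist R 'I_L).
Let eta := eps / 8.
Let th := 3 * eps / 4.
Let grow := 1 + eps ^+ 2 / 512.
Let start := delta * eps ^+ 2 / (132 * L)%:R.
Hypothesis eps01 : 0 <= eps < 1.
Hypothesis M_gt0 : (0 < M)%N.
Hypothesis test_length : forall i, (i <= M)%N -> (start * grow ^+ i <= 1) = (i < M)%N.

Definition time_learn (r : nat) : nat :=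
  528 * L + r * (2 * time_attempt L m T M (2 * r) + 9) + 60.

Lemma simulator_learnP (fin : seq (entry R n L) -> R) (psi : val R -> R) r
    (l : seq (n.-tuple bool * 'I_L)) :
  size l = (r * (2 * (m + M)))%N -> (forall w, 0 <= psi w) ->
  (forall h, history_valid A B h -> (size h <= 2 * r)%N ->
     fin h <= psi (Cons (Num eta) (enc_history h))) ->
  process M A B eta th p0 fin r [::] l <=
  ev (time_learn r) (init (subroutines A B) (simulator_learn L m)
    (Cons (Num eps) (Cons (Num delta) (enc_points R l)))) (fun s => psi (s 0)).
Proof.
move=> sl psi0 le.
pose s0 := init_store (Cons (Num eps) (Cons (Num delta) (enc_points R l))).
rewrite -[ev _ _ _]/(wp (subroutines A B) (simulator_learn L m) (time_learn r)
  (fun s => psi (s 0)) s0).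
rewrite /simulator_learn; set b1 := [:: (rX, _); _; _; _; _; _; _; _].
set b2 := [:: (rA, EAdd _ _); _; _; _; _; _; _; _; _; _; _; _; _; _; _].
set tl := (r * (2 * time_attempt L m T M (2 * r) + 9)).+1.
have tE : (time_learn r = 528 * L + tl + 59)%N by rewrite /time_learn /tl; lia.
apply: (@wp_seq_ok _ _ _ _ 17 (528 * L + tl + 41) _ _ _ _ (eq (exec b1 s0))) => //; first lia.
  exact: ok_block.
move=> _ <-; set s1 := exec b1 s0.
have one1 : num (s1 rOne) = 1 by [].
apply: (@wp_seq_ok _ _ _ _ (4 * (132 * L) + 3) (tl + 37) _ _ _ _ _ _ _
  (@numeralP R _ rB (132 * L) s1 isT one1)) => //; first lia.
move=> s2 [B2 f2].
apply: (@wp_seq_ok _ _ _ _ 31 (tl + 2) _ _ _ _ (eq (exec b2 s2))) => //; first lia.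
  exact: ok_block.
move=> _ <-; set s3 := exec b2 s2.
apply: (@wp_seq_leq _ _ _ _ tl 1) => //; first lia.
have eta_ : eps / (1 + 1) / (1 + 1) / (1 + 1) = eta by rewrite /eta; field.
have eta01 : 0 <= eta < 1 by rewrite /eta; move: eps01; lra.
have st3 : learner_state eta th grow start [::] l s3.
  split; [by rewrite /s3 /= /upd /= (f2 rH isT) | by rewrite /s3 /= /upd /= (f2 rData isT) |].
  split; rewrite /s3 /= /upd /= ?(f2 rOne isT) ?(f2 rSum isT) ?(f2 rD isT) ?B2 /s1 /= /upd /=.
  + by rewrite eta_.
  + by [].
  + by rewrite /start expr2.
  + by rewrite eta_ /th /eta; field.
  + by rewrite eta_ /grow /eta; field.
have go3 : s3 rGo = s3 rData.
  by rewrite /s3 /= /upd /= (f2 rGo isT) (f2 rData isT).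
rewrite /tl; apply: (@roundsP R n L m T M A B eta th grow start p0 eta01 M_gt0 test_length
  fin (2 * r) r [::] l s3 _ I _ sl st3 go3) => [|s'|].
- exact: leqnn.
- exact: wp_ge0.
move=> s' h' vh' sh' H' E'.
apply: (@ok_assign _ _ _ _ _ _ (eq _)) => [|s''|_ <-]; [by [] | exact: psi0 |].
by rewrite /upd /= H' E'; apply: le.
Qed.

End LearnerCorrectness.

(** * Means and concentration *)

Section MeanOverLists.
Variables (R : realType) (Z : finType) (p : Z -> R).
Implicit Types (F G : seq Z -> R).

(** An iterated sum, unlike [iid_mean], lets data be split and consumed from the head, as [process]
    does; [iid_meanE] connects the two. *)
Fixpoint list_mean k F : R :=
  if k is k'.+1 then \sum_z p z * list_mean k' (fun l => F (z :: l)) else F [::].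

Lemma eq_list_mean k F G :
  (forall l, size l = k -> F l = G l) -> list_mean k F = list_mean k G.
Proof.
elim: k F G => [|k IH] F G FG /=; first exact: FG.
by apply: eq_bigr => z _; congr (_ * _); apply: IH => l sl; apply: FG; rewrite /= sl.
Qed.

Lemma iid_meanE k F : iid_mean p (fun z : k.-tuple Z => F z) = list_mean k F.
Proof.
elim: k F => [|k IH] F; rewrite /iid_mean /=.
  rewrite (big_pred1 [tuple]) => [|z]; last by apply/esym/eqP; exact: tuple0.
  by rewrite big_ord0 mul1r.
rewrite (reindex (fun q : Z * k.-tuple Z => cons_tuple q.1 q.2)) /=; last first.
  exists (fun t => (thead t, behead_tuple t)) => [[z t] _|t _].
    by congr pair; apply: val_inj.
  by rewrite [RHS]tuple_eta; apply: val_inj.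
rewrite -(pair_bigA _ (fun z (t : k.-tuple Z) =>
  (\prod_(i < k.+1) p (tnth (cons_tuple z t) i)) * F (z :: t))) /=.
apply: eq_bigr => z _; rewrite -IH /iid_mean mulr_sumr; apply: eq_bigr => t _.
rewrite big_ord_recl mulrA; congr (_ * _ * _).
by apply: eq_bigr => i _; congr p; rewrite !(tnth_nth z).
Qed.

Lemma list_mean_cat a b F :
  list_mean (a + b) F = list_mean a (fun l1 => list_mean b (fun l2 => F (l1 ++ l2))).
Proof. by elim: a F => //= a IH F; apply: eq_bigr => z _; rewrite IH. Qed.

Lemma list_mean_sum k (I : Type) (r : seq I) (w : I -> R) (F : I -> seq Z -> R) :
  list_mean k (fun l => \sum_(i <- r) w i * F i l) = \sum_(i <- r) w i * list_mean k (F i).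
Proof.
elim: k F => //= k IH F; under eq_bigr do rewrite IH mulr_sumr.
rewrite exchange_big /=; apply: eq_bigr => i _; rewrite mulr_sumr.
by apply: eq_bigr => z _; rewrite mulrCA.
Qed.

Lemma list_meanZ k (a : R) F : list_mean k (fun l => a * F l) = a * list_mean k F.
Proof.
by elim: k F => //= k IH F; rewrite mulr_sumr; apply: eq_bigr => z _; rewrite IH mulrCA.
Qed.

Lemma list_mean_rcons k F :
  list_mean k.+1 F = list_mean k (fun l => \sum_z p z * F (rcons l z)).
Proof.
elim: k F => // k IH F; apply: eq_bigr => z _; congr (_ * _).
exact: (IH (fun l => F (z :: l))).
Qed.

(** Exchangeability; needed because the accumulator holds the drawn points in reverse order. *)
Lemma list_mean_rev k F : list_mean k (fun l => F (rev l)) = list_mean k F.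
Proof.
elim: k F => // k IH F; rewrite list_mean_rcons list_mean_sum /=.
apply: eq_bigr => z _; rewrite -(IH (fun l => F (z :: l))); congr (_ * _).
by apply: eq_list_mean => l _; rewrite rev_rcons.
Qed.

Lemma list_mean_prod k (f : Z -> R) :
  list_mean k (fun l => \prod_(z <- l) f z) = (\sum_z p z * f z) ^+ k.
Proof.
elim: k => [|k IH] /=; first by rewrite big_nil.
rewrite exprS mulr_suml; apply: eq_bigr => z _; rewrite -IH -mulrA -(list_meanZ k (f z)).
by congr (_ * _); apply: eq_list_mean => l _; rewrite big_cons.
Qed.

Lemma list_mean_ev k t cf (F : seq Z -> store R -> R) :
  list_mean k (fun l => ev t cf (F l)) = ev t cf (fun s => list_mean k (fun l => F l s)).
Proof.
elim: k F => //= k IH F; rewrite ev_sum; apply: eq_bigr => z _.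
by rewrite IH.
Qed.

Hypothesis p_ge0 : forall z, 0 <= p z.

Lemma ler_list_mean k F G :
  (forall l, size l = k -> F l <= G l) -> list_mean k F <= list_mean k G.
Proof.
elim: k F G => [|k IH] F G FG /=; first exact: FG.
apply: ler_sum => z _; rewrite ler_wpM2l //; apply: IH => l sl; apply: FG.
by rewrite /= sl.
Qed.

Lemma list_mean_ge0 k F : (forall l, 0 <= F l) -> 0 <= list_mean k F.
Proof.
elim: k F => [|k IH] F F0 /=; first exact: F0.
by rewrite sumr_ge0 // => z _; rewrite mulr_ge0 // IH.
Qed.

Hypothesis p_sum1 : \sum_z p z = 1.

Lemma list_mean_cst k (a : R) : list_mean k (fun=> a) = a.
Proof. by elim: k => //= k IH; rewrite IH -mulr_suml p_sum1 mul1r. Qed.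

Lemma list_meanB k (b : R) F : list_mean k (fun l => b - F l) = b - list_mean k F.
Proof.
elim: k F => //= k IH F; under eq_bigr do rewrite IH mulrBr.
by rewrite big_split /= sumrN -mulr_suml p_sum1 mul1r.
Qed.

Lemma list_mean_lower k F b : (forall l, size l = k -> b <= F l) -> b <= list_mean k F.
Proof. by move=> bF; rewrite -(list_mean_cst k b); exact: ler_list_mean. Qed.

End MeanOverLists.

(** * Elementary bounds on the exponential and the logarithm *)

Section RealInequalities.
Variable R : realType.
Implicit Types x y : R.

(** From [1 - x <= expR (- x)], the exponential is at most the inverse of [1 - x]. Multiplying the
    quadratic by [1 - x] gives [1 + x ^+ 2 * (1 - 2 * x)], which is at least 1 exactly because
    [x <= 1 / 2]. *)
Lemma expR_le_quadratic x : x <= 1 / 2 -> expR x <= 1 + x + 2 * x ^+ 2.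
Proof.
move=> x2; have := expR_ge1Dx (- x); rewrite expRN => le.
have x1 : 0 < 1 - x by lra.
apply: le_trans (_ : (1 - x)^-1 <= _).
  by rewrite -(invrK (expR x)) lef_pV2 ?posrE ?invr_gt0 ?expR_gt0.
rewrite -div1r ler_pdivrMr //.
have -> : (1 + x + 2 * x ^+ 2) * (1 - x) = 1 + x ^+ 2 * (1 - 2 * x) by ring.
by rewrite lerDl mulr_ge0 ?sqr_ge0 //; lra.
Qed.

Lemma ln_ge_quadratic x : x <= 1 / 2 -> - x - 2 * x ^+ 2 <= ln (1 - x).
Proof.
move=> x2; have x1 : 0 < 1 - x by lra.
rewrite -ler_expR lnK ?posrE //.
have -> : - x - 2 * x ^+ 2 = - (x + 2 * x ^+ 2) by ring.
rewrite expRN invf_ple ?posrE ?expR_gt0 //.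
apply: le_trans (expR_ge1Dx _).
rewrite -div1r ler_pdivrMr //.
have -> : (1 + (x + 2 * x ^+ 2)) * (1 - x) = 1 + x ^+ 2 * (1 - 2 * x) by ring.
by rewrite lerDl mulr_ge0 ?sqr_ge0 //; lra.
Qed.

Lemma ln_le_sub1 x : 0 < x -> ln x <= x - 1.
Proof.
by move=> x0; have := @le_ln1Dx R (x - 1); rewrite (addrC 1) subrK; apply; lra.
Qed.

End RealInequalities.

Section Chernoff.
Variables (R : realType) (Z : finType) (p : Z -> R).
Hypotheses (p_ge0 : forall z, 0 <= p z) (p_sum1 : \sum_z p z = 1).

(** The bound is a power of [1 + eps ^+ 2 / 512] instead of an exponential because the learner can
    compute that power, and stops its test by it. *)
Lemma chernoff (Y : Z -> R) (a eps : R) k :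
  (forall z, -2 <= Y z <= 2) -> 0 < eps < 1 -> \sum_z p z * Y z <= a - eps / 4 ->
  list_mean p k (fun l => (0 <= \sum_(z <- l) (Y z - a))%R%:R) <=
  ((1 + eps ^+ 2 / 512) ^+ k)^-1.
Proof.
(* This [lam] minimises the exponent [- lam * eps / 4 + 8 * lam ^+ 2] of the moment bound, with
   value [- eps ^+ 2 / 512]; the 8 comes from [2 * (lam * Y z) ^+ 2] and the range of [Y]. *)
move=> Yb e01 mean; have [e0 e1] := andP e01; pose lam := eps / 64.
have lam0 : 0 < lam by rewrite /lam; lra.
have lam1 : lam <= 1 / 64 by rewrite /lam; lra.
apply: le_trans (_ : list_mean p k (fun l => \prod_(z <- l) expR (lam * (Y z - a))) <= _).
  apply: ler_list_mean => // l _; case: (leP 0 _) => [S0|_] /=; last first.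
    by apply: prodr_ge0 => z _; exact: expR_ge0.
  have -> : \prod_(z <- l) expR (lam * (Y z - a)) = expR (lam * \sum_(z <- l) (Y z - a)).
    by rewrite mulr_sumr expR_sum.
  by rewrite -[1%:R]expR0 ler_expR mulr_ge0 // ltW.
rewrite list_mean_prod -exprVn lerXn2r ?nnegrE //.
- by apply: sumr_ge0 => z _; rewrite mulr_ge0 ?expR_ge0.
- by rewrite invr_ge0; nra.
set S := \sum_z p z * Y z in mean.
apply: le_trans (_ : \sum_z p z * (expR (- (lam * a)) * (1 + lam * Y z + 8 * lam ^+ 2)) <= _).
  apply: ler_sum => z _; rewrite ler_wpM2l // mulrBr expRD mulrC expRN.
  rewrite ler_wpM2l ?invr_ge0 ?expR_ge0 //.
  have /andP[Y1 Y2] := Yb z.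
  have lY : lam * Y z <= lam * 2 by rewrite ler_wpM2l // ltW.
  apply: le_trans (expR_le_quadratic _) _; first lra.
  have : (lam * Y z) ^+ 2 <= lam ^+ 2 * 4.
    rewrite exprMn ler_wpM2l ?sqr_ge0 //.
    have -> : (4 : R) = 2 ^+ 2 by ring.
    by rewrite -(real_normK (num_real (Y z))) lerXn2r ?nnegrE // ler_norml Y1.
  lra.
have -> : \sum_z p z * (expR (- (lam * a)) * (1 + lam * Y z + 8 * lam ^+ 2)) =
    expR (- (lam * a)) * (1 + (lam * S + 8 * lam ^+ 2)).
  transitivity (expR (- (lam * a)) * (\sum_z p z * (1 + 8 * lam ^+ 2) + lam * S)).
    rewrite /S mulr_sumr -big_split mulr_sumr; apply: eq_bigr => z _ /=; ring.
  by rewrite -mulr_suml p_sum1; ring.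
apply: le_trans (_ : expR (- (lam * a)) * expR (lam * S + 8 * lam ^+ 2) <= _).
  by rewrite ler_wpM2l ?expR_ge0 ?expR_ge1Dx.
rewrite -expRD; apply: le_trans (_ : expR (- (eps ^+ 2 / 512)) <= _).
  rewrite ler_expR.
  have : lam * S <= lam * (a - eps / 4) by rewrite ler_wpM2l // ltW.
  rewrite /lam; nra.
rewrite expRN lef_pV2 ?posrE ?expR_gt0 ?expR_ge1Dx //; nra.
Qed.

End Chernoff.

(** * Analysis of the learner *)

Section Analysis.
Variables (R : realType) (n L m T M : nat).
Notation X := (n.-tuple bool).
Notation Delta := (fdist R 'I_L).
Notation vec := {ffun 'I_L -> R}.
Variables (A : distinguishing_oracle R n L m T) (B : calibration_oracle R L m T).
Variables (eps delta' : R) (p0 : Delta) (mu : fdist R X) (gstar : X -> Delta).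
Let eta := eps / 8.
Let th := 3 * eps / 4.
Hypothesis eps01 : 0 < eps < 1.
Hypothesis delta'_ge0 : 0 <= delta'.

Notation sim := (sim eta p0).
Notation entry := (entry R n L).
Notation oracle := (oracle A B).
Notation entry_valid := (entry_valid A B).
Notation entry_describes := (entry_describes A B).
Notation history_valid := (history_valid A B).
Notation stat := (stat eta p0).
Notation passes := (passes eta th p0).
Notation draw := (draw eta p0).
Notation tested := (tested M A B eta th p0).
Notation attempt_mean := (attempt_mean M A B eta th p0).
Notation process := (process M A B eta th p0).
Notation mean1 := (list_mean (mu_1 mu gstar)).
Implicit Types (h : seq entry) (l : seq (X * 'I_L)) (k : bool).

Let eta01 : 0 <= eta < 1.
Proof. by rewrite /eta; move: eps01; lra. Qed.

Lemma sum_mu_1 (g : X -> Delta) (F : X -> 'I_L -> R) :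
  \sum_z mu_1 mu g z * F z.1 z.2 = \sum_x mu x * \sum_y g x y * F x y.
Proof.
rewrite -(pair_bigA _ (fun x y => mu x * g x y * F x y)) /=.
by apply: eq_bigr => x _; rewrite mulr_sumr; apply: eq_bigr => y _; rewrite mulrA.
Qed.

Lemma sum_mu_2 (s g : X -> Delta) (F : X -> 'I_L -> 'I_L -> R) :
  \sum_z mu_2 mu s g z * F z.1.1 z.1.2 z.2 =
  \sum_x mu x * \sum_y s x y * \sum_y' g x y' * F x y y'.
Proof.
rewrite -(pair_bigA _ (fun q y' => mu q.1 * s q.1 q.2 * g q.1 y' * F q.1 q.2 y')) /=.
rewrite -(pair_bigA _ (fun x y => \sum_y' mu x * s x y * g x y' * F x y y')) /=.
apply: eq_bigr => x _; rewrite mulr_sumr; apply: eq_bigr => y _.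
by rewrite !mulr_sumr; apply: eq_bigr => y' _; rewrite !mulrA.
Qed.

Lemma mu_1_ge0 (g : X -> Delta) z : 0 <= mu_1 mu g z.
Proof. by rewrite mulr_ge0 ?fdist_ge0. Qed.

Lemma mu_2_ge0 (s g : X -> Delta) z : 0 <= mu_2 mu s g z.
Proof. by rewrite !mulr_ge0 ?fdist_ge0. Qed.

Lemma mu_1_sum1 (g : X -> Delta) : \sum_z mu_1 mu g z = 1.
Proof.
have := sum_mu_1 g (fun _ _ => 1); rewrite /=; under eq_bigr do rewrite mulr1.
move=> ->; rewrite -[RHS](fdist_sum1 mu); apply: eq_bigr => x _.
by under eq_bigr do rewrite mulr1; rewrite fdist_sum1 mulr1.
Qed.

Lemma mu_2_sum1 (s g : X -> Delta) : \sum_z mu_2 mu s g z = 1.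
Proof.
have := sum_mu_2 s g (fun _ _ _ => 1); rewrite /=; under eq_bigr do rewrite mulr1.
move=> ->; rewrite -[RHS](fdist_sum1 mu); apply: eq_bigr => x _.
rewrite -[RHS]mulr1 -[in RHS](fdist_sum1 (s x)); congr (_ * _); apply: eq_bigr => y _.
by under eq_bigr do rewrite mulr1; rewrite fdist_sum1 mulr1.
Qed.

Hint Resolve mu_1_ge0 mu_2_ge0 mu_1_sum1 mu_2_sum1 : core.

Definition gain (e : entry) h : R :=
  advantage mu (sim h) gstar (fun x => efun e x (sim h x)).

Lemma mean_stat e h : \sum_z mu_1 mu gstar z * stat e h z = gain e h.
Proof.
have := sum_mu_1 gstar (fun x y => stat e h (x, y)).
under eq_bigr do rewrite -surjective_pairing; move=> ->.
rewrite /gain /advantage /inner; apply: eq_bigr => x _; congr (_ * _).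
rewrite /stat /=; set f := efun e x (sim h x).
under eq_bigr do rewrite mulrBr; rewrite big_split /= -mulr_suml fdist_sum1 mul1r.
by rewrite -big_split /=; apply: eq_bigr => y _; rewrite !ffunE mulrBl.
Qed.

Lemma stat_bound e h p : entry_valid e -> -2 <= stat e h p <= 2.
Proof.
move=> [eb _]; rewrite /stat; set v := sim h p.1; set f := efun e p.1 v.
have f1 y : -1 <= f y <= 1 by exact: eb.
have le1 : \sum_y v y * f y <= 1.
  rewrite -(fdist_sum1 v); apply: ler_sum => y _; have /andP[_ fy] := f1 y.
  by rewrite -[X in _ <= X]mulr1 ler_wpM2l ?fdist_ge0.
have ge1 : -1 <= \sum_y v y * f y.
  rewrite -(fdist_sum1 v) -sumrN; apply: ler_sum => y _; have /andP[fy _] := f1 y.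
  by rewrite -[X in X <= _]mulr1 mulNr -mulrN ler_wpM2l ?fdist_ge0.
have := f1 p.2; lra.
Qed.

(* Cross entropy of [gstar] relative to [sim h]. *)
Definition potential h : R := \sum_z mu_1 mu gstar z * - ln (sim h z.1 z.2).

Lemma potential_ge0 h : history_valid h -> 0 <= potential h.
Proof.
move=> vh; apply: sumr_ge0 => z _; rewrite mulr_ge0 // oppr_ge0 ln_le0 //.
rewrite -(fdist_sum1 (sim h z.1)) (bigD1 z.2) //= lerDl sumr_ge0 // => y _.
exact: fdist_ge0.
Qed.

Lemma potential_nil : potential [::] = ln L%:R.
Proof.
have L0 : 0 < L%:R :> R by rewrite ltr0n (fdist_labels_gt0 p0).
rewrite /potential; under eq_bigr do rewrite uniformE lnV ?posrE // opprK.
by rewrite -mulr_suml mu_1_sum1 mul1r.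
Qed.

(** The inequality holds at each point [(x, y)], with [stat] in place of the gain. The update adds
    [ln Z - ln (1 - eta * f y)] to the negative logarithm, where the normaliser [Z] is 1 minus [eta]
    times the mean of [f]. Then [ln Z <= Z - 1] gives the mean term of [stat], and the quadratic
    bound on the other logarithm costs [2 * eta ^+ 2]. *)
Lemma potential_cons e h : entry_valid e -> history_valid h ->
  potential (e :: h) <= potential h - eta * gain e h + 2 * eta ^+ 2.
Proof.
move=> [eb _] vh; rewrite -mean_stat.
have -> : potential h - eta * (\sum_z mu_1 mu gstar z * stat e h z) + 2 * eta ^+ 2 =
    \sum_z mu_1 mu gstar z * (- ln (sim h z.1 z.2) - eta * stat e h z + 2 * eta ^+ 2).
  have c2 : 2 * eta ^+ 2 = \sum_z mu_1 mu gstar z * (2 * eta ^+ 2).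
    by rewrite -mulr_suml mu_1_sum1 mul1r.
  rewrite {1}c2 mulr_sumr -sumrN -!big_split.
  by apply: eq_bigr => z _ /=; ring.
apply: ler_sum => -[x y] _; rewrite ler_wpM2l //=; set v := sim h x; set f := efun e x v.
have v0 z : 0 < v z by exact: (sim_gt0 (A := A) (B := B)).
have f1 z : -1 <= f z <= 1 by exact: eb.
have Z0 := sum_weight_gt0 eta01 f1 v0.
have /andP[e0 e1] : 0 < eta < 1 / 8 by rewrite /eta; move: eps01; lra.
have ef : `|eta * f y| <= eta.
  by rewrite normrM gtr0_norm // -[X in _ <= X]mulr1 ler_wpM2l ?(ltW e0) // ler_norml.
have [efl efu] : - eta <= eta * f y /\ eta * f y <= eta.
  by move: ef; rewrite ler_norml => /andP.
have ef0 : 0 < 1 - eta * f y by lra.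
rewrite reweightE // lnM ?posrE ?invr_gt0 ?weight_gt0 // lnV ?posrE //.
rewrite /weight lnM ?posrE //.
have lnZ := ln_le_sub1 Z0.
have E : \sum_z weight eta v f z = 1 - eta * \sum_z v z * f z.
  rewrite -(fdist_sum1 v) mulr_sumr -sumrN -big_split; apply: eq_bigr => z _ /=.
  by rewrite /weight; ring.
have lnf : - (eta * f y) - 2 * (eta * f y) ^+ 2 <= ln (1 - eta * f y).
  by apply: ln_ge_quadratic; lra.
have sq : (eta * f y) ^+ 2 <= eta ^+ 2.
  by rewrite -(real_normK (num_real (eta * f y))) lerXn2r ?nnegrE // ltW.
rewrite /stat -/v -/f /= ; move: lnZ; rewrite E.
set S := \sum_z v z * f z => lnZ.
have -> : eta * (S - f y) = eta * S - eta * f y by ring.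
rewrite /weight in lnZ *; lra.
Qed.

Notation triple := (X * 'I_L * 'I_L)%type.
Notation mean2 h := (list_mean (mu_2 mu (sim h) gstar)).

Definition enc_sample k h (z : triple) : val R :=
  sampled eta p0 k h (z.1.1, z.2) (enc_label R z.1.2).

Definition push_samples k h (acc : val R) (zs : seq triple) : val R :=
  foldl (fun a z => Cons (enc_sample k h z) a) acc zs.

Lemma push_samplesE k h zs :
  push_samples k h Nil zs = enc_seq (map (enc_sample k h) (rev zs)).
Proof.
rewrite /push_samples -[zs in LHS]revK foldl_rev /enc_seq.
by elim: (rev zs) => //= z l ->.
Qed.

(** Given x, the two labels are independent, so drawing the label of gstar first and that of [sim h]
    afterwards still yields the law [mu_2], for which the oracles are specified. *)
Lemma list_mean_draw k h c j acc gamma :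
  mean1 (c + j) (fun l => draw k h c l acc gamma) =
  mean2 h c (fun zs => mean1 j (fun l => gamma (push_samples k h acc zs) l)).
Proof.
elim: c acc => // c IH acc; rewrite addSn /=.
under eq_bigr => z _ do rewrite list_mean_sum.
pose Q (x : X) (y' y : 'I_L) := mean2 h c (fun zs => mean1 j (fun l =>
  gamma (push_samples k h (Cons (sampled eta p0 k h (x, y') (enc_label R y)) acc) zs) l)).
transitivity (\sum_z mu_1 mu gstar z * (fun x y' => \sum_y sim h x y * Q x y' y) z.1 z.2).
  apply: eq_bigr => -[x y'] _; congr (_ * _); apply: eq_bigr => y _; congr (_ * _).
  exact: IH.
rewrite (sum_mu_1 gstar (fun x y' => \sum_y sim h x y * Q x y' y)).
transitivity (\sum_z mu_2 mu (sim h) gstar z * (fun x y y' => Q x y' y) z.1.1 z.1.2 z.2); last first.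
  by apply: eq_bigr.
rewrite (sum_mu_2 (sim h) gstar (fun x y y' => Q x y' y)).
apply: eq_bigr => x _; congr (_ * _).
under eq_bigr do rewrite mulr_sumr.
rewrite exchange_big /=; apply: eq_bigr => y _; rewrite mulr_sumr.
by apply: eq_bigr => y' _; rewrite mulrCA.
Qed.

Lemma output_valid k h (zs : seq triple) : size zs = m ->
  prob_from T (init [::] (learn (oracle k)) (push_samples k h Nil zs))
    (fun d => exists F, entry_valid (Entry k d F)) = 1.
Proof.
move=> sz; rewrite push_samplesE; set P := fun d => _.
have impl (P' : val R -> Prop) cf : prob_from T cf P' = 1 -> (forall d, P' d -> P d) ->
    prob_from T cf P = 1.
  by move=> p1 PP'; apply: le_anti; rewrite prob_from_le1 -p1 le_prob_from.
have srz : size (rev zs) == m by rewrite size_rev sz.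
case: k @P impl => P impl.
  have sw : size [seq (sim h z.1.1, z.1.2, z.2) | z <- rev zs] == m by rewrite size_map.
  have := calib_algP B (Tuple sw); rewrite /prob_returns /= -map_comp => H.
  apply: impl H _ => d [r [rb rd]]; exists (fun _ v => r v); split; first by move=> x v y; exact: rb.
  by move=> x v; exact: rd.
have := dist_algP A (Tuple srz); rewrite /prob_returns /= => H.
apply: impl H _ => d [f [fb fd]]; exists (fun x _ => f x); split; first by move=> x v y; exact: fb.
by move=> x v; exact: fd.
Qed.

Definition fooled k h : Prop :=
  if k then calibrated mu B eps delta' (sim h) gstar
  else indistinguishable mu A eps delta' (sim h) gstar.

Definition good_output k h (d : val R) : Prop :=
  exists F, entry_describes (Entry k d F) /\ eps < gain (Entry k d F) h.

Lemma not_fooled k h : ~ fooled k h ->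
  1 - delta' <= mean2 h m (fun zs =>
    prob_from T (init [::] (learn (oracle k)) (push_samples k h Nil zs)) (good_output k h)).
Proof.
(* The oracle receives the points in reverse order, which does not change their law. *)
move=> nf; rewrite -list_mean_rev.
under eq_list_mean do rewrite push_samplesE revK.
case: k nf => /contrapT; rewrite /miscalibrated /distinguishable => H; apply: (le_trans H).
  rewrite -iid_meanE; apply: ler_sum => z _; rewrite ler_wpM2l //.
    by apply: prodr_ge0 => i _.
  by apply: le_prob_from => d [r [rd rg]]; exists (fun _ v => r v); split=> // x v; exact: rd.
rewrite -iid_meanE; apply: ler_sum => z _; rewrite ler_wpM2l //.
  by apply: prodr_ge0 => i _.
by apply: le_prob_from => d [f [fd fg]]; exists (fun x _ => f x); split=> // x v; exact: fd.
Qed.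

Lemma enc_vec_inj (u v : vec) : enc_vec u = enc_vec v -> u = v.
Proof.
rewrite /enc_vec => e; apply/ffunP => y; move: (mem_enum 'I_L y); rewrite inE => yL.
elim: (enum 'I_L) e yL => //= z s IH [uv e]; rewrite inE => /orP[/eqP->//|]; exact: IH.
Qed.

(** If the values differed, the same run would return both with probability 1, and by [prob_fromI]
    an impossible event would have probability 1. *)
Lemma entry_describes_inj k d F F' x v :
  entry_describes (Entry k d F) -> entry_describes (Entry k d F') -> F x v = F' x v.
Proof.
move=> /(_ x v) /= p1 /(_ x v) /= p2; apply: enc_vec_inj.
have [//|ne] := pselect (enc_vec (F x v) = enc_vec (F' x v)).
have le2 : 1 <= prob_from T (init [::] (evaluate (oracle k)) (Cons d (point k x v)))
    (fun w => w = enc_vec (F' x v)) by rewrite -[X in X <= _]p2.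
have := prob_fromI p1 le2.
set pr := prob_from _ _ _; suff -> : pr = 0 by rewrite ler10.
apply: le_anti; rewrite /pr prob_from_ev ev_ge0 ?andbT; last by move=> s; case: asbool.
rewrite -[X in _ <= X](mulr0 0); apply: le_trans (_ : ev T _ (fun=> 0) <= _).
  by apply: le_ev => s; rewrite asboolF // => -[-> ?].
by rewrite mulr0 ev_cst.
Qed.

Lemma tested_ge0 k h l beta d : (forall p h' l', 0 <= beta p h' l') ->
  0 <= tested k h l beta d.
Proof.
by move=> b0; rewrite /tested; case: pselect => // ex; case: ifP => _; exact: b0.
Qed.

Lemma draw_ge0 k h c l acc gamma : (forall a l', 0 <= gamma a l') ->
  0 <= draw k h c l acc gamma.
Proof.
move=> g0; elim: c l acc => [|c IH] [|p l] acc //=; try exact: g0.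
by apply: sumr_ge0 => y _; rewrite mulr_ge0 ?fdist_ge0.
Qed.

Lemma attempt_mean_ge0 k h l beta : (forall p h' l', 0 <= beta p h' l') ->
  0 <= attempt_mean k h l beta.
Proof.
by move=> b0; apply: draw_ge0 => a l'; apply: ev_ge0 => s; exact: tested_ge0.
Qed.

Lemma process_ge0 fin r h l : (forall h', 0 <= fin h') -> 0 <= process fin r h l.
Proof.
move=> f0; elim: r h l => [|r IH] h l /=; first exact: f0.
apply: attempt_mean_ge0 => p1 h1 l1; apply: attempt_mean_ge0 => p2 h2 l2.
by case: ifP.
Qed.

Let rho := ((1 + eps ^+ 2 / 512) ^+ M)^-1.

Lemma rho_ge0 : 0 <= rho.
Proof. by rewrite invr_ge0 exprn_ge0 // addr_ge0 // divr_ge0 ?sqr_ge0. Qed.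

(** The threshold [3 * eps / 4] is midway between [eps / 2] and [eps], which leaves to both kinds of
    error the margin [eps / 4] of [chernoff]. *)
Lemma pass_unlikely e h : entry_valid e -> gain e h <= eps / 2 ->
  mean1 M (fun l => (passes e h l)%:R) <= rho.
Proof.
move=> ve small; apply: chernoff => // [z|]; first exact: stat_bound.
by rewrite mean_stat /th; lra.
Qed.

Lemma fail_unlikely e h : entry_valid e -> eps <= gain e h ->
  mean1 M (fun l => (~~ passes e h l)%:R) <= rho.
Proof.
move=> ve large; have H := @chernoff R _ (mu_1 mu gstar) (mu_1_ge0 _) (mu_1_sum1 _)
  (fun z => - stat e h z) (- th) eps M.
apply: le_trans (H _ _ _) => //.
- apply: ler_list_mean => // l _; rewrite /passes; case: (leP 0 (\sum_(z <- l) _)) => //= neg.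
  rewrite ler_nat lt0b.
  have -> : \sum_(z <- l) (- stat e h z - - th) = - \sum_(z <- l) (stat e h z - th).
    by rewrite -sumrN; apply: eq_bigr => z _; ring.
  by rewrite oppr_ge0 ltW.
- by move=> z; have := @stat_bound e h z ve; lra.
- under eq_bigr do rewrite mulrN.
  by rewrite sumrN mean_stat /th; lra.
Qed.

(** At most one verdict is harmful, so [rho] is lost only once. If the gain is at least [eps / 2],
    passing is fine, and failing hurts only for a good output, whose gain exceeds [eps]. If the gain
    is smaller, the output is not good, failing is fine, and only passing hurts. A harmful verdict
    costs at most [b <= 1]. *)
Lemma tested_mean_lower k h j beta d (b : R) : b <= 1 ->
  (forall p h' l', 0 <= beta p h' l') -> (exists F, entry_valid (Entry k d F)) ->
  (forall e, entry_valid e -> eps / 2 <= gain e h -> b <= mean1 j (beta true (e :: h))) ->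
  b <= mean1 j (beta false h) \/ good_output k h d ->
  b - rho <= mean1 (M + j) (fun l => tested k h l beta d).
Proof.
move=> b1 beta0 ex large small; rewrite list_mean_cat /tested.
case: pselect => // ex'; case: cid => F ve; rewrite [projT1 _]/=; set e := Entry k d F.
set bT := mean1 j (beta true (e :: h)); set bF := mean1 j (beta false h).
have bT0 : 0 <= bT by exact: list_mean_ge0.
have bF0 : 0 <= bF by exact: list_mean_ge0.
have -> : mean1 M (fun l1 => mean1 j (fun l2 =>
    if passes e h (take M (l1 ++ l2)) then beta true (e :: h) (drop M (l1 ++ l2))
    else beta false h (drop M (l1 ++ l2)))) =
    mean1 M (fun l1 => if passes e h l1 then bT else bF).
  apply: eq_list_mean => l1 sl1; rewrite [RHS](_ : _ = mean1 j (fun l2 =>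
    if passes e h l1 then beta true (e :: h) l2 else beta false h l2)); last by case: ifP.
  by apply: eq_list_mean => l2 _; rewrite take_size_cat // drop_size_cat.
have [ge|lt] := leP (eps / 2) (gain e h).
  have bbT : b <= bT by exact: large.
  case: small => [bbF|[F' [dF' gF']]].
    apply: le_trans (_ : b <= _); first by rewrite lerBlDr lerDl rho_ge0.
    by apply: list_mean_lower => // l _; case: ifP.
  have gE : gain e h = gain (Entry k d F') h.
    rewrite /gain; congr advantage; apply: funext => x /=.
    exact: (entry_describes_inj _ _ (proj2 ve) dF').
  apply: le_trans (_ : b - mean1 M (fun l => (~~ passes e h l)%:R) <= _).
    by rewrite lerD2l lerN2 fail_unlikely // gE ltW.
  rewrite -list_meanB //; apply: ler_list_mean => // l _.
  by case: ifP => _ /=; rewrite ?subr0 //; lra.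
case: small => [bbF|[F' [dF' gF']]]; last first.
  have gE : gain e h = gain (Entry k d F') h.
    rewrite /gain; congr advantage; apply: funext => x /=.
    exact: (entry_describes_inj _ _ (proj2 ve) dF').
  by move: lt eps01; rewrite gE; lra.
apply: le_trans (_ : b - mean1 M (fun l => (passes e h l)%:R) <= _).
  by rewrite lerD2l lerN2 pass_unlikely // ltW.
rewrite -list_meanB //; apply: ler_list_mean => // l _.
by case: ifP => _ /=; rewrite ?subr0 //; lra.
Qed.

(** A fooled oracle may be given up, so only the test can err. An oracle that is not fooled fails to
    give a good output with probability at most [delta'], and the test wrongly rejects a good output
    with probability at most [rho]. *)
Lemma attempt_mean_lower k h j beta (b : R) : b <= 1 ->
  (forall p h' l', 0 <= beta p h' l') ->
  (forall e, entry_valid e -> eps / 2 <= gain e h -> b <= mean1 j (beta true (e :: h))) ->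
  (fooled k h -> b <= mean1 j (beta false h)) ->
  b - (rho + delta') <= mean1 (m + (M + j)) (fun l => attempt_mean k h l beta).
Proof.
move=> b1 beta0 large small; rewrite list_mean_draw.
pose tau d := mean1 (M + j) (fun l => tested k h l beta d).
have tau0 d : 0 <= tau d by apply: list_mean_ge0 => // l; exact: tested_ge0.
under eq_list_mean => zs _ do rewrite /output_mean list_mean_ev -/(tau _).
have [/small le|nf] := pselect (fooled k h).
  apply: le_trans (_ : b - rho <= _); first by move: delta'_ge0; lra.
  apply: list_mean_lower => // zs szs; apply: (ev_ok (output_valid k h szs)) => [s|s ex].
    exact: tau0.
  by apply: tested_mean_lower => //; left.
(* For [c <= 0] the claim is trivial; otherwise [c <= 1] gives [c * (1 - delta') >= c - delta']. *)
set c := b - rho; have [c0|c0] := leP c 0.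
  apply: le_trans (_ : 0 <= _); first by move: delta'_ge0 c0; rewrite /c; lra.
  by apply: list_mean_ge0 => // zs; apply: ev_ge0 => s; exact: tau0.
apply: le_trans (_ : c * (1 - delta') <= _).
  by have := rho_ge0; move: delta'_ge0 c0; rewrite /c; nra.
apply: le_trans (ler_wpM2l (ltW c0) (not_fooled nf)) _; rewrite -list_meanZ.
apply: ler_list_mean => // zs szs.
apply: le_trans (ler_wpM2l (ltW c0) (prob_fromI (output_valid k h szs) (lexx _))) _.
apply: ev_markov => [|s|s [ex good]]; [exact: ltW | exact: tau0 |].
by apply: tested_mean_lower => //; right.
Qed.

(** The drop is [eta * (eps / 2) - 2 * eta ^+ 2], which is largest at [eta = eps / 8]. *)
Lemma potential_drop e h : entry_valid e -> history_valid h -> eps / 2 <= gain e h ->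
  potential (e :: h) <= potential h - eps ^+ 2 / 32.
Proof.
move=> ve vh ge; apply: le_trans (potential_cons ve vh) _; rewrite /eta.
by move: eps01; nra.
Qed.

Lemma process_lower fin r h : history_valid h -> (forall h', 0 <= fin h') ->
  (forall h', history_valid h' -> fooled false h' -> fooled true h' -> 1 <= fin h') ->
  potential h < r%:R * (eps ^+ 2 / 32) ->
  1 - r%:R * (2 * (rho + delta')) <=
  mean1 (r * (2 * (m + M))) (fun l => process fin r h l).
Proof.
move=> + fin0 fin1; elim: r h => [|r IH] h vh pot.
  by have := potential_ge0 vh; move: pot; rewrite mul0r; lra.
have d0 : 0 < eps ^+ 2 / 32 by move: eps01 => /andP[e0 _]; rewrite divr_gt0 // exprn_gt0.
have err0 : 0 <= rho + delta' by rewrite addr_ge0 ?rho_ge0.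
set b := 1 - r%:R * (2 * (rho + delta')).
have b1 : b <= 1 by rewrite lerBlDr lerDl !mulr_ge0.
have -> : (r.+1 * (2 * (m + M)) = m + (M + (m + (M + r * (2 * (m + M))))))%N by lia.
have -> : 1 - r.+1%:R * (2 * (rho + delta')) = (b - (rho + delta')) - (rho + delta').
  by rewrite /b -natr1; ring.
have beta0 p : forall p2 h2 l2, 0 <= (if p || p2 then process fin r h2 l2 else fin h2).
  by move=> p2 h2 l2; case: ifP => _ //; exact: process_ge0.
have pot_le h' : history_valid h' -> potential h' <= potential h - eps ^+ 2 / 32 ->
    b <= mean1 (r * (2 * (m + M))) (fun l => process fin r h' l).
  move=> vh' le; apply: IH => //; apply: le_lt_trans le _.
  by rewrite ltrBlDr; move: pot; rewrite -natr1 mulrDl mul1r.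
apply: attempt_mean_lower => [|p h1 l1|e ve ge|f1].
- by lra.
- by apply: attempt_mean_ge0.
- have drop1 := potential_drop ve vh ge.
  apply: attempt_mean_lower => // [e' ve' ge'|_]; last exact: pot_le.
  have drop2 := potential_drop ve' (conj ve vh : history_valid (e :: h)) ge'.
  by apply: pot_le => //; apply: le_trans drop2 _; lra.
(* The first attempt has left [h] unchanged, so the learner stops only if both oracles fail on the
   same function. *)
- apply: attempt_mean_lower => // [e ve ge|f2].
    by apply: pot_le => //; exact: potential_drop.
  by apply: list_mean_lower => // l _; apply: le_trans b1 _; exact: fin1.
Qed.

Lemma draw_lower k h c l acc gamma (b : R) : (c <= size l)%N ->
  (forall zs, size zs = c -> b <= gamma (push_samples k h acc zs) (drop c l)) ->
  b <= draw k h c l acc gamma.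
Proof.
elim: c l acc => [|c IH] [|p l] acc //= cl le; try exact: (le [::]).
rewrite -[b]mul1r -(fdist_sum1 (sim h p.1)) mulr_suml; apply: ler_sum => y _.
rewrite ler_wpM2l ?fdist_ge0 //; apply: IH => // zs szs.
by apply: (le ((p.1, y, p.2) :: zs)); rewrite /= szs.
Qed.

Lemma attempt_mean_ge1 k h l beta : (m <= size l)%N ->
  (forall p h' l', 0 <= beta p h' l') ->
  (forall e, entry_valid e -> 1 <= beta true (e :: h) (drop M (drop m l))) ->
  1 <= beta false h (drop M (drop m l)) -> 1 <= attempt_mean k h l beta.
Proof.
move=> ml beta0 le1 le0; apply: draw_lower => // zs szs.
apply: (ev_ok (output_valid k h szs)) => [s|s ex]; first exact: tested_ge0.
rewrite /tested; case: pselect => // ex'; case: cid => F ve; case: ifP => _ //.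
exact: le1.
Qed.

(** Termination must hold for every data set, not on average; it is the case [fin = 1], where every
    verdict of a test is acceptable. *)
Lemma process_ge1 r h l : history_valid h -> size l = (r * (2 * (m + M)))%N ->
  1 <= process (fun=> 1) r h l.
Proof.
elim: r h l => // r IH h l vh sl.
have beta0 p : forall p2 h2 l2,
    0 <= (if p || p2 then process (fun=> 1) r h2 l2 else 1).
  by move=> p2 h2 l2; case: ifP => _ //; apply: process_ge0 => *.
have second p h1 : history_valid h1 ->
    1 <= attempt_mean true h1 (drop M (drop m l)) (fun p2 h2 l2 =>
      if p || p2 then process (fun=> 1) r h2 l2 else 1).
  move=> vh1; apply: attempt_mean_ge1 => // [|e ve|]; first by rewrite !size_drop sl; nia.
    by rewrite orbT; apply: IH => //; rewrite !size_drop sl; nia.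
  by case: ifP => // _; apply: IH => //; rewrite !size_drop sl; nia.
apply: attempt_mean_ge1 => [|p h1 l1|e ve|].
- by rewrite sl; nia.
- exact: attempt_mean_ge0.
- by apply: (second true).
- exact: (second false).
Qed.

End Analysis.

(** * Numbers of rounds and of tests *)

Section Polynomials.
Variables (R : realType) (k : nat).
Implicit Types F G : k.-tuple R -> R.

Definition is_polynomial F : Prop := exists p : mpoly.mpoly k R, forall v, peval p v = F v.

Lemma polynomialD F G : is_polynomial F -> is_polynomial G -> is_polynomial (fun v => F v + G v).
Proof.
move=> [p pF] [q qG]; eexists => v; rewrite -pF -qG.
exact: (mpoly.mevalD (tnth v) p q).
Qed.

Lemma polynomialM F G : is_polynomial F -> is_polynomial G -> is_polynomial (fun v => F v * G v).
Proof.
move=> [p pF] [q qG]; eexists => v; rewrite -pF -qG.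
exact: (mpoly.mevalM (tnth v) p q).
Qed.

Lemma polynomial_cst (a : R) : is_polynomial (fun=> a).
Proof. by exists (mpoly.mpolyC k a) => v; rewrite /peval mpoly.mevalC. Qed.

Lemma polynomial_nth i : (i < k)%N -> is_polynomial (fun v => nth 0 v i).
Proof.
move=> ik; exists (mpoly.mpolyX R (mpoly.mnm1 (Ordinal ik))) => v.
by rewrite /peval mpoly.mevalXU (tnth_nth 0).
Qed.

End Polynomials.

Ltac prove_polynomial :=
  repeat first [apply: polynomialD | apply: polynomialM | exact: polynomial_nth
               | exact: polynomial_cst].

Section Sizes.
Variable R : realType.
Implicit Types (eps delta : R) (L m T r M : nat).

(** The successor makes [lt_rounds] strict, as [process_lower] demands of the initial potential
    [ln L]. *)
Definition rounds L eps : nat := (Num.truncn (32 * ln L%:R / eps ^+ 2)).+1.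

(** The least number of growth steps that bring [rP] above 1, by [test_sizeP]. *)
Definition test_size L eps delta : nat :=
  (Num.truncn (ln ((132 * L)%:R / (delta * eps ^+ 2)) / ln (1 + eps ^+ 2 / 512))).+1.

Lemma ln_nat_ge0 L : 0 <= ln L%:R :> R.
Proof. by case: L => [|L]; [rewrite ln0 | rewrite ln_ge0 // ler1n]. Qed.

Lemma ln_nat_ge_half L : (2 <= L)%N -> 1 / 2 <= ln L%:R :> R.
Proof.
move=> L2; have le2 : ln (2 : R) <= ln L%:R by rewrite ler_ln ?posrE ?ler_nat ?ltr0n // ltnW.
have lnh : ln (2^-1 : R) <= 2^-1 - 1 by apply: ln_le_sub1; rewrite invr_gt0.
rewrite lnV ?posrE // in lnh; clear L2; lra.
Qed.

Lemma ln_growth_ge eps : 0 < eps < 1 / 2 -> eps ^+ 2 / 1024 <= ln (1 + eps ^+ 2 / 512).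
Proof.
move=> e01; have := @ln_ge_quadratic R (- (eps ^+ 2 / 512)); rewrite opprK => le.
apply: le_trans (le _); last by have := sqr_ge0 eps; lra.
have e2 : 0 <= eps ^+ 2 <= 1 by rewrite sqr_ge0 /=; nra.
by nra.
Qed.

Lemma rounds_le L eps : 0 < eps -> (rounds L eps)%:R <= 32 * ln L%:R * (1 / eps * (1 / eps)) + 1.
Proof.
move=> e0; rewrite /rounds -natr1 lerD2r.
have -> : 32 * ln L%:R * (1 / eps * (1 / eps)) = 32 * ln L%:R / eps ^+ 2.
  by field; rewrite gt_eqF.
by rewrite truncn_le divr_ge0 ?sqr_ge0 // mulr_ge0 // ln_nat_ge0.
Qed.

Lemma lt_rounds L eps : 0 < eps -> ln L%:R < (rounds L eps)%:R * (eps ^+ 2 / 32).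
Proof.
move=> e0; have := truncnS_gt (32 * ln L%:R / eps ^+ 2); rewrite ltr_pdivrMr ?exprn_gt0 //.
rewrite -/(rounds L eps); lra.
Qed.

(** Absorbs the [+ 1] from rounding up the number of rounds; [k] will be [L] or [ln L]. *)
Lemma le_33_of_le_32D (x l k e : R) :
  x <= 32 * l + e -> e <= 1 / 4 -> l <= k -> 1 / 2 <= k -> x <= 33 * k.
Proof. lra. Qed.

Section TestSize.
Variables (L : nat) (eps delta : R).
Hypotheses (L0 : (0 < L)%N) (e01 : 0 < eps < 1 / 2) (d01 : 0 < delta < 1 / 2).
Let q := (132 * L)%:R / (delta * eps ^+ 2).

Let de0 : 0 < delta * eps ^+ 2.
Proof. by move: e01 d01 => /andP[e0 _] /andP[d0 _]; rewrite mulr_gt0 ?exprn_gt0. Qed.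

Let q1 : 1 <= q.
Proof.
rewrite /q ler_pdivlMr // mul1r; have L1 : 1 <= L%:R :> R by rewrite ler1n.
have [/andP[e0 e1] /andP[d0 d1]] := conj e01 d01.
have e2 : eps ^+ 2 <= 1 by rewrite expr_le1 ?ltW //; lra.
apply: le_trans (_ : 1 * 1 <= _); first by rewrite ler_pM ?sqr_ge0 // ltW //; lra.
by rewrite natrM; lra.
Qed.

Lemma test_sizeP i : (delta * eps ^+ 2 / (132 * L)%:R * (1 + eps ^+ 2 / 512) ^+ i <= 1) =
  (i < test_size L eps delta)%N.
Proof.
have g1 : 1 < 1 + eps ^+ 2 / 512.
  by move: e01 => /andP[e0 _]; rewrite ltrDl divr_gt0 ?exprn_gt0.
have g0 : 0 < 1 + eps ^+ 2 / 512 by lra.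
have lg : 0 < ln (1 + eps ^+ 2 / 512) by rewrite ln_gt0.
have q0 : 0 < q by exact: lt_le_trans ltr01 q1.
rewrite /test_size ltnS truncn_ge_nat; last by rewrite divr_ge0 ?ln_ge0 // ltW.
rewrite -/q ler_pdivlMr // mulr_natl -lnXn // ler_ln ?posrE ?exprn_gt0 //.
have -> : delta * eps ^+ 2 / (132 * L)%:R = q^-1 by rewrite /q invf_div.
by rewrite mulrC ler_pdivrMr // mul1r.
Qed.

Lemma test_size_le : (test_size L eps delta)%:R <=
  1024 * (1 / eps * (1 / eps)) * (132 + ln L%:R + ln (1 / delta) + 2 * (1 / eps)) + 1.
Proof.
have [/andP[e0 e1] /andP[d0 d1]] := conj e01 d01.
have lg := ln_growth_ge e01; have L1 : 0 < L%:R :> R by rewrite ltr0n.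
have e20 : 0 < eps ^+ 2 / 1024 by rewrite divr_gt0 ?exprn_gt0.
have lq : 0 <= ln q by rewrite ln_ge0.
rewrite /test_size -natr1 lerD2r.
apply: le_trans (_ : ln q / ln (1 + eps ^+ 2 / 512) <= _).
  by rewrite truncn_le divr_ge0 // (le_trans _ lg) // ltW.
apply: le_trans (_ : ln q / (eps ^+ 2 / 1024) <= _).
  by rewrite ler_wpM2l // lef_pV2 ?posrE // (lt_le_trans e20 lg).
have -> : ln q / (eps ^+ 2 / 1024) = 1024 * (1 / eps * (1 / eps)) * ln q.
  by field; rewrite gt_eqF.
have E0 : 0 < 1 / eps by rewrite divr_gt0.
have E20 : 0 <= 1024 * (1 / eps * (1 / eps)).
  by apply: mulr_ge0 => //; apply: mulr_ge0; exact: ltW.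
rewrite ler_wpM2l //.
(* The logarithm of [q] splits into those of its factors. Those of 132 and [1 / eps] are bounded by
   their arguments, so that only quantities allowed in the polynomial remain. *)
have -> : q = 132 * L%:R * (1 / delta) * (1 / eps) * (1 / eps).
  by rewrite /q natrM; field; rewrite !gt_eqF.
have D0 : 0 < 1 / delta by rewrite divr_gt0.
move: (1 / eps) (1 / delta) E0 D0 => E D E0 D0.
rewrite !lnM ?posrE ?mulr_gt0 //.
have l132 : ln (132 : R) <= 132 - 1 by apply: ln_le_sub1.
by have := ln_le_sub1 E0; lra.
Qed.

Lemma test_error : ((1 + eps ^+ 2 / 512) ^+ test_size L eps delta)^-1 <=
  delta * eps ^+ 2 / (132 * L)%:R.
Proof.
have := test_sizeP (test_size L eps delta); rewrite ltnn => /negbT; rewrite -ltNge => gt1.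
have g0 : 0 < (1 + eps ^+ 2 / 512) ^+ test_size L eps delta.
  by rewrite exprn_gt0 // ltr_pwDl // divr_ge0 ?sqr_ge0.
by rewrite -div1r ler_pdivrMr // ltW.
Qed.

(** Origin of [132 = 2 * 2 * 33]: two attempts per round, two sources of error that get half of
    [delta] each, and [33 * L] or [33 * ln L] as a bound on the number of rounds times
    [eps ^+ 2]. *)
Lemma total_error delta' : delta' = 1 / 132 * (delta * eps ^+ 2 / ln L%:R) ->
  (rounds L eps)%:R * (2 * (((1 + eps ^+ 2 / 512) ^+ test_size L eps delta)^-1 + delta'))
  <= delta.
Proof.
move=> dE; have [/andP[e0 e1] /andP[d0 d1]] := conj e01 d01.
have L1 : 1 <= L%:R :> R by rewrite ler1n.
have LL : 0 < L%:R :> R by lra.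
have K := rounds_le L e0; set K_ := (rounds L eps)%:R in K *.
have K0 : 0 <= K_ by rewrite /K_.
have lnL := ln_le_sub1 LL; have e20 : 0 < eps ^+ 2 by rewrite exprn_gt0.
have e2 : eps ^+ 2 <= 1 / 4 by nra.
have KE : K_ * eps ^+ 2 <= 32 * ln L%:R + eps ^+ 2.
  have -> : 32 * ln L%:R + eps ^+ 2 =
      (32 * ln L%:R * (1 / eps * (1 / eps)) + 1) * eps ^+ 2 by field; rewrite gt_eqF.
  by rewrite ler_wpM2r // ltW.
clear K.
have first : K_ * (2 * ((1 + eps ^+ 2 / 512) ^+ test_size L eps delta)^-1) <= delta / 2.
  apply: le_trans (_ : K_ * (2 * (delta * eps ^+ 2 / (132 * L)%:R)) <= _).
    by rewrite !ler_wpM2l // test_error.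
  have -> : K_ * (2 * (delta * eps ^+ 2 / (132 * L)%:R)) =
      delta * (K_ * eps ^+ 2) / (66 * L%:R) by rewrite natrM; field; rewrite gt_eqF.
  rewrite ler_pdivrMr ?mulr_gt0 //.
  have -> : delta / 2 * (66 * L%:R) = delta * (33 * L%:R) by field.
  rewrite ler_wpM2l ?(ltW d0) //; apply: (le_33_of_le_32D KE e2); lra.
have second : K_ * (2 * delta') <= delta / 2.
  (* For [L = 1] the denominator [ln L] is 0, and so is [delta'] by the convention on division. *)
  have [L2|L2] := leqP 2 L; last first.
    have -> : delta' = 0.
      have L1' : L = 1%N by apply/eqP; rewrite eqn_leq L0 andbT -ltnS.
      by rewrite dE L1' ln1 invr0 !mulr0.
    by rewrite !mulr0 divr_ge0 // ltW.
  have ln2 := ln_nat_ge_half L2; clear L2.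
  have lnL0 : 0 < ln L%:R :> R by apply: lt_le_trans ln2; rewrite divr_gt0.
  have -> : K_ * (2 * delta') = delta * (K_ * eps ^+ 2) / (66 * ln L%:R).
    by rewrite dE; field; rewrite gt_eqF.
  rewrite ler_pdivrMr ?mulr_gt0 //.
  have -> : delta / 2 * (66 * ln L%:R) = delta * (33 * ln L%:R) by field.
  rewrite ler_wpM2l ?(ltW d0) //; exact: (le_33_of_le_32D KE e2 (lexx _) ln2).
by rewrite [X in _ <= X](splitr delta) !mulrDr lerD.
Qed.

End TestSize.

End Sizes.

(** * Running times as polynomials in real variables *)

Section Complexity.
Variable R : realType.
Implicit Types (Lr mr Tr kr tr : R).

Definition simulate_bound Lr Tr kr : R := (2 * kr + 1) * (30 * Lr + Tr + 38).

Definition learn_bound Lr mr Tr kr tr : R :=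
  528 * Lr + kr * (2 * (mr * (simulate_bound Lr Tr kr + 17 * Lr + 31) +
    tr * (simulate_bound Lr Tr kr + Tr + 23 * Lr + 56) + Tr + 40) + 9) + 60.

Ltac monotone :=
  repeat first [exact: lexx | assumption | exact: ler0n | apply: addr_ge0 | apply: mulr_ge0
               | apply: lerD | apply: ler_pM].

Lemma simulate_bound_le Lr Tr kr kr' : 0 <= Lr -> 0 <= Tr -> 0 <= kr -> kr <= kr' ->
  simulate_bound Lr Tr kr <= simulate_bound Lr Tr kr'.
Proof. by move=> *; rewrite /simulate_bound; monotone. Qed.

Lemma learn_bound_le Lr mr Tr kr kr' tr tr' :
  0 <= Lr -> 0 <= mr -> 0 <= Tr -> 0 <= kr -> 0 <= tr -> kr <= kr' -> tr <= tr' ->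
  learn_bound Lr mr Tr kr tr <= learn_bound Lr mr Tr kr' tr'.
Proof.
move=> L0 m0 T0 k0 t0 kk tt; have S := simulate_bound_le L0 T0 k0 kk.
have S0 : 0 <= simulate_bound Lr Tr kr by rewrite /simulate_bound; monotone.
by rewrite /learn_bound; monotone.
Qed.

Lemma time_simulateE L T r :
  (time_simulate L T (2 * r))%:R = simulate_bound L%:R T%:R r%:R :> R.
Proof. by rewrite /time_simulate /simulate_bound !(natrM, natrD, =^~ natr1). Qed.

Lemma time_learnE L m T M r :
  (time_learn L m T M r)%:R = learn_bound L%:R m%:R T%:R r%:R M%:R :> R.
Proof.
rewrite /learn_bound -time_simulateE /time_learn /time_attempt.
by move: (time_simulate _ _ _) => S; rewrite !(natrM, natrD); ring.
Qed.

End Complexity.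

(** * The simulator and its guarantee *)

Definition simulator (L m : nat) : algorithm :=
  Algorithm (simulator_learn L m) (simulator_evaluate L).

Lemma simulator_correct (R : realType) (n L m T M r N : nat)
    (A : distinguishing_oracle R n L m T) (B : calibration_oracle R L m T)
    (eps delta : R) (p0 : fdist R 'I_L) (z : N.-tuple (n.-tuple bool * 'I_L))
    (P : (n.-tuple bool -> fdist R 'I_L) -> Prop) :
  0 < eps < 1 / 2 -> (0 < M)%N ->
  (forall i, (i <= M)%N ->
     (delta * eps ^+ 2 / (132 * L)%:R * (1 + eps ^+ 2 / 512) ^+ i <= 1) = (i < M)%N) ->
  N = (r * (2 * (m + M)))%N ->
  process M A B (eps / 8) (3 * eps / 4) p0
    (fun h => (`[< P (sim (eps / 8) p0 h) >])%:R) r [::] z <=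
  prob_simulator A B (simulator L m) (time_learn L m T M r)
    (time_simulate L T (2 * r) + 14) eps delta z P.
Proof.
move=> e01 M0 test NE; have e01' : 0 <= eps < 1 by lra.
rewrite /prob_simulator /prob_returns prob_from_ev.
pose Q d := exists s : n.-tuple bool -> fdist R 'I_L,
  describes (subroutines A B) (simulator L m) (time_simulate L T (2 * r) + 14)
    (@enc_bits R n) d (fun x => (s x : {ffun 'I_L -> R})) /\ P s.
apply: (@simulator_learnP _ _ _ _ _ _ A B eps delta p0 e01' M0 test _ (fun w => (`[< Q w >])%:R)).
- by rewrite size_tuple NE.
- by move=> w; case: asbool.
move=> h vh hr; case: (asboolP (P _)) => [Ps|_]; last by case: asbool.
rewrite asboolT //; exists (sim (eps / 8) p0 h); split=> // x.
apply: (@prob_returns_leq _ _ _ _ (time_simulate L T (size h) + 14)).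
  by rewrite leq_add2r /time_simulate leq_mul2r ltnS hr orbT.
by apply: simulator_evaluateP vh => //; lra.
Qed.

Theorem theorem3p10 (R : realType) :
  exists (p_data : mpoly.mpoly 4 R) (p_learn p_eval : mpoly.mpoly 5 R) (c : R),
  0 < c /\
  forall (n L m T : nat) (mu : fdist R (n.-tuple bool))
    (A : distinguishing_oracle R n L m T) (B : calibration_oracle R L m T),
  exists (S : algorithm) (N t t' : R -> R -> nat),
  forall gstar : n.-tuple bool -> fdist R 'I_L,
  forall eps delta : R, 0 < eps < 1 / 2 -> 0 < delta < 1 / 2 ->
  [/\ (N eps delta)%:R <=
        peval p_data [tuple m%:R; ln L%:R; 1 / eps; ln (1 / delta)],
      (t eps delta)%:R <=
        peval p_learn [tuple m%:R; T%:R; L%:R; 1 / eps; ln (1 / delta)],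
      (t' eps delta)%:R <=
        peval p_eval [tuple m%:R; T%:R; L%:R; 1 / eps; ln (1 / delta)],
      forall z : (N eps delta).-tuple (n.-tuple bool * 'I_L),
        prob_simulator A B S (t eps delta) (t' eps delta) eps delta z
          (fun _ => True) = 1
    & 1 - delta <=
      iid_mean (mu_1 mu gstar)
        (fun z : (N eps delta).-tuple (n.-tuple bool * 'I_L) =>
           prob_simulator A B S (t eps delta) (t' eps delta) eps delta z
             (fun s =>
                let delta' := c * (delta * eps ^+ 2 / ln L%:R) in
                indistinguishable mu A eps delta' s gstar /\
                calibrated mu B eps delta' s gstar))].
Proof.
(* Bounds on the numbers of rounds and of test points. The argument [l] is [ln L] for the data and
   [L] for the times, whose polynomials do not have [ln L] as a variable. *)
pose bk (l e : R) : R := 32 * l * (e * e) + 1.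
pose bt (l e d : R) : R := 1024 * (e * e) * (132 + l + d + 2 * e) + 1.
have [p_data dataE] : @is_polynomial R 4 (fun v =>
    bk (nth 0 v 1) (nth 0 v 2) * (2 * (nth 0 v 0 + bt (nth 0 v 1) (nth 0 v 2) (nth 0 v 3)))).
  by rewrite /bk /bt; prove_polynomial.
have [p_learn learnE] : @is_polynomial R 5 (fun v =>
    learn_bound (nth 0 v 2) (nth 0 v 0) (nth 0 v 1) (bk (nth 0 v 2) (nth 0 v 3))
      (bt (nth 0 v 2) (nth 0 v 3) (nth 0 v 4))).
  by rewrite /learn_bound /simulate_bound /bk /bt; prove_polynomial.
have [p_eval evalE] : @is_polynomial R 5 (fun v =>
    simulate_bound (nth 0 v 2) (nth 0 v 1) (bk (nth 0 v 2) (nth 0 v 3)) + 14).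
  by rewrite /simulate_bound /bk; prove_polynomial.
exists p_data, p_learn, p_eval, (1 / 132); split; first by rewrite divr_gt0.
move=> n L m T mu A B; exists (simulator L m).
exists (fun eps delta => rounds L eps * (2 * (m + test_size L eps delta)))%N.
exists (fun eps delta => time_learn L m T (test_size L eps delta) (rounds L eps)).
exists (fun eps _ => (time_simulate L T (2 * rounds L eps) + 14)%N).
move=> gstar eps delta e01 d01; cbv beta.
set M := test_size L eps delta; set r := rounds L eps.
(* Any value of gstar witnesses that there is a label. *)
have /andP[e0 e1] := e01; have p0 := gstar [tuple of nseq n false].
have L0 := fdist_labels_gt0 p0.
have L1 : 0 < L%:R :> R by rewrite ltr0n.
have e01' : 0 < eps < 1 by lra.
have test i (_ : (i <= M)%N) := test_sizeP L0 e01 d01 i.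
have lnL : ln L%:R <= L%:R :> R by have := ln_le_sub1 L1; lra.
have E0 : 0 <= 1 / eps by rewrite divr_ge0 // ltW.
have EE0 : 0 <= 1 / eps * (1 / eps) by exact: mulr_ge0.
have rk : r%:R <= bk (ln L%:R) (1 / eps) by exact: rounds_le.
have Mk : M%:R <= bt (ln L%:R) (1 / eps) (ln (1 / delta)) by exact: test_size_le.
have rk' : r%:R <= bk L%:R (1 / eps).
  by apply: le_trans rk _; rewrite /bk lerD2r ler_wpM2r // ler_wpM2l.
have Mk' : M%:R <= bt L%:R (1 / eps) (ln (1 / delta)).
  by apply: le_trans Mk _; rewrite /bt lerD2r ler_wpM2l ?(mulr_ge0 _ EE0) // !lerD2r lerD2l.
split.
- rewrite dataE /= !(natrM, natrD); apply: ler_pM => //; first by rewrite mulr_ge0 ?addr_ge0 //.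
  by rewrite ler_wpM2l // lerD2l.
- by rewrite learnE /= time_learnE learn_bound_le.
- by rewrite evalE /= natrD time_simulateE lerD2r simulate_bound_le.
- move=> z; apply: le_anti; apply/andP; split; first exact: prob_from_le1.
  apply: le_trans (@simulator_correct R n L m T M r _ A B eps delta p0 z (fun=> True) e01
    (ltn0Sn _) test erefl).
  rewrite (_ : (fun h => _) = fun=> 1); last by apply: funext => h; rewrite asboolT.
  by apply: (process_ge1 (eps := eps)); rewrite ?size_tuple.
pose delta' := 1 / 132 * (delta * eps ^+ 2 / ln L%:R).
have d'0 : 0 <= delta'.
  have /andP[/ltW d0 _] := d01; have num0 := mulr_ge0 d0 (sqr_ge0 eps).
  by apply: mulr_ge0; [exact: divr_ge0 | exact: divr_ge0 num0 (ln_nat_ge0 _ _)].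
pose P s := indistinguishable mu A eps delta' s gstar /\ calibrated mu B eps delta' s gstar.
apply: (@le_trans _ _ (list_mean (mu_1 mu gstar) (r * (2 * (m + M)))
  (process M A B (eps / 8) (3 * eps / 4) p0
    (fun h => (`[< P (sim (eps / 8) p0 h) >])%:R) r [::]))); last first.
  rewrite -iid_meanE /iid_mean; apply: ler_sum => z _; rewrite ler_wpM2l //.
    by apply: prodr_ge0 => i _; exact: mu_1_ge0.
  exact: (@simulator_correct R n L m T M r _ A B eps delta p0 z P e01 (ltn0Sn _) test erefl).
apply: le_trans (@process_lower R n L m T M A B eps delta' p0 mu gstar e01' d'0 _ r [::] _ _ _ _) => //.
- by rewrite lerD2l lerN2; exact: (total_error L0 e01 d01 (erefl delta')).
- by move=> h vh fA fB; rewrite asboolT.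
- by rewrite potential_nil; exact: lt_rounds.
Qed.
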